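(* Suppose the step size $\gamma>0$ and epoch size $m$ are chosen such that $$0<\theta:=\frac{\frac{1}{\mu\gamma m}+2L(1+2\sqrt{\Delta}\,\tau)(\gamma+\tau\mu\gamma^2)}{1-2L(1+2\sqrt{\Delta}\,\tau)(\gamma+\tau\mu\gamma^2)}<1.$$ Then KROMAGNON converges in expectation at a geometric rate: for all $k\ge0$, $$\mathbb{E}f(\tilde x_k)-f(x^* )\le\theta^k\,(f(x_0)-f(x^* )),$$ where $\tilde x_k$ is the initial iterate of epoch $k$, obtained for $k\ge1$ by choosing uniformly at random among the inconsistent read iterates of the previous epoch (and $\tilde x_0=x_0$).
   Context: Let $f(x)=\frac1n\sum_{i=1}^n f_i(x)$ on $\mathbb{R}^d$, where each $f_i$ is convex and differentiable with $L$-Lipschitz gradient $f_i'$, and $f$ is $\mu$-strongly convex ($\mu>0$). Let $x^*$ be the minimizer of $f$. $[x]_v$ denotes coordinate $v$ of $x$. For each $i$, $S_i\subseteq\{1,\dots,d\}$ is the support of $f_i'$, i.e. the set of coordinates where $f_i'$ can be nonzero. $P_{S_i}$ is the coordinate projection onto $S_i$; $p_v:=\frac1n|\{i:v\in S_i\}|$; $D$ is diagonal with entries $1/p_v$; $D_i:=P_{S_i}D$. The sparsity constant is $\Delta:=\frac1n\max_{v}|\{i:v\in S_i\}|\in[\frac1n,1]$. KROMAGNON (asynchronous parallel sparse SVRG; step size $\gamma$, epoch size $m$). Start from a deterministic $\tilde x_0=x_0$. Epoch $k=0,1,2,\dots$ consists of the iterations labeled $km\le t\le(k+1)m-1$. At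 its beginning all cores are synchronized, the full gradient $f'(\tilde x_k)$ is computed, and the shared memory vector $x$ is set to $\tilde x_k$. During the epoch, several cores repeat in parallel, without locks: read all coordinates of $x$ (possibly inconsistently, i.e. coordinates are read at different times while other cores write), giving $\hat x$; sample $i$ uniformly in $\{1,\dots,n\}$; compute $g=f_i'(\hat x)-f_i'(\tilde x_k)+D_if'(\tilde x_k)$; for each $v\in S_i$ atomically do $[x]_v\leftarrow[x]_v-\gamma[g]_v$. At the end of the epoch (all writes completed), $\tilde x_{k+1}$ is chosen uniformly at random among $\hat x_{km},\dots,\hat x_{(k+1)m-1}$. Labeling (''after read''): iterations are labeled $t$ in the order in which their reads are completed; $\hat x_t$, $i_t$, $g_t$ are the read vector, sampled index and computed direction of iteration $t$. $i_t$ is uniform on $\{1,\dots,n\}$ and independent of everything in the past of the completed read $t$ (all $\hat x_u$, $u\le t$, all $i_u$, $u<t$, and the $\tilde x_j$ chosen so far). Bounded overlap assumption with constant $\tau\ge0$ (integer): an iteration is being processed from the start of its read to the end of its writes, and iterations $r$ and $t$ are never processed concurrently when $r\ge t+\tau+1$. Hence, with virtual iterates defined within epoch $k$ by $x_{km}:=\tilde x_k$ and $x_{t+1}:=x_t-\gamma g_t$, one has $\hat x_t-x_t=\gamma\sum_{u=\max(km,\,t-\tau)}^{t-1}G_u^tg_u$ for $km\le t\le(k+1)m-1$, where $G_u^t$ are (random) diagonal matrices with entries in $\{0,1\}$. *)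

(* Defs.v *)
From HB Require Import structures.
From mathcomp Require Import all_boot all_order all_algebra.
From mathcomp Require Import all_classical all_reals all_analysis.

Set Implicit Arguments.
Unset Strict Implicit.
Unset Printing Implicit Defensive.

Import Order.TTheory GRing.Theory Num.Theory.
Import numFieldNormedType.Exports.

Local Open Scope classical_set_scope.
Local Open Scope ring_scope.

Section Objective.
Context {R : realType} {d n : nat}.
Implicit Types (x y : 'rV[R]_d) (g : 'rV[R]_d -> R) (fs : 'I_n -> 'rV[R]_d -> R).

(* The library norm on 'rV[R]_d is the sup norm. *)
Definition enorm x : R := Num.sqrt (\sum_v x 0 v ^+ 2).

Definition grad g x : 'rV[R]_d := \row_v 'd g x (delta_mx 0 v).

Definition lipschitz_grad (L : R) g : Prop :=
  forall x y, enorm (grad g x - grad g y) <= L * enorm (x - y).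

Definition strongly_convex (mu : R) g : Prop :=
  forall x y (a : R), 0 <= a <= 1 ->
    g (a *: x + (1 - a) *: y) <=
    a * g x + (1 - a) * g y - mu / 2 * a * (1 - a) * enorm (x - y) ^+ 2.

Definition avg fs x : R := n%:R^-1 * \sum_i fs i x.

Definition supp fs (i : 'I_n) : {set 'I_d} :=
  [set v | `[< exists x, grad (fs i) x 0 v <> 0 >]]%SET.

Definition coord_count fs (v : 'I_d) : nat := #|[set i | v \in supp fs i]%SET|.

Definition coord_freq fs (v : 'I_d) : R := n%:R^-1 * (coord_count fs v)%:R.

Definition sparsity fs : R := n%:R^-1 * (\max_v coord_count fs v)%:R.

Definition coord_proj_mx (S : {set 'I_d}) : 'M[R]_d := diag_mx (\row_v (v \in S)%:R).

(* When p_v = 0 the entry is 0^-1 = 0; no S_i then contains v, so D_i does not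
   depend on this value. *)
Definition D_mx fs : 'M[R]_d := diag_mx (\row_v (coord_freq fs v)^-1).

Definition Di_mx fs (i : 'I_n) : 'M[R]_d := coord_proj_mx (supp fs i) *m D_mx fs.

(* Vectors are rows and D_i is diagonal, so D_i f' is written f' *m D_i. *)
Definition svrg_direction fs (i : 'I_n) xhat xtilde : 'rV[R]_d :=
  grad (fs i) xhat - grad (fs i) xtilde + grad (avg fs) xtilde *m Di_mx fs i.

End Objective.

Section FiniteRandomVariables.
Context {disp : measure_display} {Omega : measurableType disp} {R : realType}.
Variables (P : probability Omega R) (T : finType) (X : Omega -> T).

Definition discrete_rv : Prop :=
  forall j : T, measurable (X @^-1` [set j]).

Definition uniform_rv : Prop :=
  forall j : T, P (X @^-1` [set j]) = (#|T|%:R^-1)%:E.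

Definition independent_of (F : set (set Omega)) : Prop :=
  forall (A : set Omega) (j : T), F A ->
    P (A `&` X @^-1` [set j]) = (P A * P (X @^-1` [set j]))%E.

End FiniteRandomVariables.

(* Iterations carry global labels t; iteration t belongs to epoch t %/ m.
   The five times are those of the start of the read, of the read of
   coordinate v, of the completion of the read, of the atomic write of
   coordinate v (meaningful only for v in S_{i_t}), and of the end of the
   writes. *)
Record execution (Omega : Type) (R : realType) (d n m : nat) := Execution {
  xhat : nat -> Omega -> 'rV[R]_d ;
  idx : nat -> Omega -> 'I_n ;
  xtilde : nat -> Omega -> 'rV[R]_d ;
  pick_idx : nat -> Omega -> 'I_m ;
  t_start : nat -> Omega -> R ;
  t_read : nat -> 'I_d -> Omega -> R ;
  t_done : nat -> Omega -> R ;
  t_write : nat -> 'I_d -> Omega -> R ;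
  t_end : nat -> Omega -> R }.

Section Kromagnon.
Context {disp : measure_display} {Omega : measurableType disp} {R : realType}.
Context {d n m : nat}.
Variables (P : probability Omega R) (fs : 'I_n -> 'rV[R]_d -> R).
Variables (gamma : R) (x0 : 'rV[R]_d) (E : execution Omega R d n m).
Implicit Types (t u k : nat) (v : 'I_d) (w : Omega) (s : R).

Definition direction t w : 'rV[R]_d :=
  svrg_direction fs (idx E t w) (xhat E t w) (xtilde E (t %/ m) w).

(* [x]_v in shared memory at time s of epoch k: the value xtilde_k it is reset
   to, plus the increments of the atomic writes made before s. *)
Definition memory k s v w : R :=
  xtilde E k w 0 v +
  \sum_(k * m <= u < k.+1 * m |
          (v \in supp fs (idx E u w)) && (t_write E u v w < s))
     (- gamma * direction u w 0 v).

Definition timing : Prop := forall t w,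
  [/\ forall v, t_start E t w <= t_read E t v w <= t_done E t w,
      t_start E t w <= t_done E t w <= t_end E t w &
      forall v, v \in supp fs (idx E t w) ->
        t_done E t w <= t_write E t v w <= t_end E t w].

Definition after_read_labeling : Prop := forall t u w,
  (t <= u)%N -> t_done E t w <= t_done E u w.

Definition epochs_synchronized : Prop := forall t u w,
  (t %/ m < u %/ m)%N -> t_end E t w < t_start E u w.

Definition processed t w s : Prop := t_start E t w <= s <= t_end E t w.

Definition bounded_overlap (tau : nat) : Prop := forall r t w,
  (t + tau + 1 <= r)%N -> ~ exists s, processed r w s /\ processed t w s.

(* sigma-algebra generated by xhat_u (u < a), i_u (u < b), xtilde_j (j < c) *)
Definition history (a b c : nat) : set (set Omega) :=
  <<s [set A | exists u v (B : set R),
         [/\ (u < a)%N, measurable B & A = [set w | B (xhat E u w 0 v)]]]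
      `|` [set A | exists u (i : 'I_n),
         (u < b)%N /\ A = idx E u @^-1` [set i]]
      `|` [set A | exists j v (B : set R),
         [/\ (j < c)%N, measurable B & A = [set w | B (xtilde E j w 0 v)]]] >>.

(* No measurability of the times is required. *)
Record kromagnon (tau : nat) : Prop := Kromagnon {
  xhat_measurable : forall t v, measurable_fun setT (fun w => xhat E t w 0 v) ;
  idx_measurable : forall t, discrete_rv (idx E t) ;
  pick_measurable : forall k, discrete_rv (pick_idx E k) ;
  start_at : forall w, xtilde E 0 w = x0 ;
  timing_ok : timing ;
  labeling_ok : after_read_labeling ;
  epochs_ok : epochs_synchronized ;
  overlap_ok : bounded_overlap tau ;
  read_ok : forall t v w,
    xhat E t w 0 v = memory (t %/ m) (t_read E t v w) v w ;
  idx_uniform : forall t, uniform_rv P (idx E t) ;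
  idx_independent : forall t,
    independent_of P (idx E t) (history t.+1 t (t %/ m).+1) ;
  next_snapshot : forall k w,
    xtilde E k.+1 w = xhat E (k * m + pick_idx E k w) w ;
  pick_uniform : forall k, uniform_rv P (pick_idx E k) ;
  pick_independent : forall k,
    independent_of P (pick_idx E k) (history (k.+1 * m) (k.+1 * m) k.+1) }.

End Kromagnon.

Section VirtualIterates.
Context {disp : measure_display} {Omega : measurableType disp} {R : realType}.
Context {d n m : nat}.
Variables (P : probability Omega R) (fs : 'I_n -> 'rV[R]_d -> R).
Variables (gamma : R) (x0 : 'rV[R]_d) (E : execution Omega R d n m) (tau : nat).

Definition virtual_iterate (t : nat) (w : Omega) : 'rV[R]_d :=
  xtilde E (t %/ m) w
  - gamma *: \sum_(t %/ m * m <= u < t) direction fs E u w.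

Let add_coordE (A B : 'rV[R]_d) v : (A + B) 0 v = A 0 v + B 0 v.
Proof. by rewrite mxE. Qed.
Let opp_coordE (A : 'rV[R]_d) v : (- A) 0 v = - A 0 v.
Proof. by rewrite mxE. Qed.
Let scale_coordE (a : R) (A : 'rV[R]_d) v : (a *: A) 0 v = a * A 0 v.
Proof. by rewrite mxE. Qed.
Let diag_coordE (A : 'rV[R]_d) (b : 'rV[R]_d) v : (A *m diag_mx b) 0 v = A 0 v * b 0 v.
Proof. by rewrite mul_mx_diag mxE. Qed.
Let row_coordE (F : 'I_d -> R) v : (\row_v F v) 0 v = F v.
Proof. by rewrite mxE. Qed.

Lemma direction_supp t w v :
  v \notin supp fs (idx E t w) -> direction fs E t w 0 v = 0.
Proof.
move=> vS; have gr0 x : grad (fs (idx E t w)) x 0 v = 0.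
  apply: contrapT => gr; move: vS; rewrite inE => /negP; apply.
  by apply/asboolP; exists x.
rewrite /direction /svrg_direction.
move: (gr0 (xhat E t w)) (gr0 (xtilde E (t %/ m) w)).
move: (grad _ (xhat E t w)) (grad _ (xtilde E (t %/ m) w)) => A B A0 B0.
rewrite !add_coordE opp_coordE A0 B0 subrr add0r /Di_mx mulmxA /D_mx /coord_proj_mx.
by rewrite !diag_coordE !row_coordE (negbTE vS) mulr0 mul0r.
Qed.

Lemma xhat_sub_virtual_iterate : kromagnon P fs gamma x0 E tau ->
  exists G : nat -> nat -> Omega -> 'I_d -> bool, forall t w,
    xhat E t w - virtual_iterate t w =
    gamma *: \sum_(maxn (t %/ m * m) (t - tau) <= u < t)
      direction fs E u w *m diag_mx (\row_v (G u t w v)%:R).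
Proof.
move=> K; exists (fun u t w v => ~~ (t_write E u v w < t_read E t v w)) => t w.
have m0 : (0 < m)%N by case: (pick_idx E 0 w) => i /=; exact: leq_ltn_trans.
apply/rowP => v; rewrite /virtual_iterate add_coordE opp_coordE add_coordE opp_coordE !scale_coordE !summxE.
rewrite (read_ok K) /memory.
set a := (t %/ m * m)%N; set b := (_ * m)%N.
have at_ : (a <= t)%N by exact: leq_divM.
have tb : (t <= b)%N by apply/ltnW; rewrite ltn_ceil.
have dr u : (direction fs E u w *m
    diag_mx (\row_v (~~ (t_write E u v w < t_read E t v w))%:R)) 0 v =
    direction fs E u w 0 v * (~~ (t_write E u v w < t_read E t v w))%:R.
  by rewrite diag_coordE row_coordE.
under [in RHS]eq_bigr do rewrite dr.
have [rv _ _] := timing_ok K t w; have /andP[srv rvd] := rv v.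
have late u : (t <= u)%N -> v \in supp fs (idx E u w) ->
    ~~ (t_write E u v w < t_read E t v w).
  move=> tu vS; have [_ _ /(_ _ vS) /andP[dw _]] := timing_ok K u w.
  rewrite -leNgt (le_trans rvd)// (le_trans _ dw)//.
  exact: (labeling_ok K).
have early u : (u < t - tau)%N -> v \in supp fs (idx E u w) ->
    t_write E u v w < t_read E t v w.
  move=> ut vS; have [_ /andP[sdu deu] /(_ _ vS) /andP[_ we]] := timing_ok K u w.
  have [_ /andP[sdt det] _] := timing_ok K t w.
  have utau : (u + tau + 1 <= t)%N by rewrite addn1 (addnC u) -ltn_subRL.
  have nov := overlap_ok K (w := w) utau.
  have dud : t_done E u w <= t_done E t w.
    by apply: (labeling_ok K); apply/ltnW/(leq_trans ut)/leq_subr.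
  apply: le_lt_trans we _; apply: lt_le_trans srv; rewrite ltNge; apply/negP => se.
  apply: nov; have [h|h] := leP (t_start E u w) (t_start E t w).
    by exists (t_start E t w); rewrite /processed lexx h se (le_trans sdt).
  exists (t_start E u w); rewrite /processed lexx (ltW h).
  by rewrite (le_trans sdu deu) (le_trans sdu (le_trans dud det)).
rewrite (big_cat_nat at_ tb)/= [X in _ + (_ + X)]big1_seq ?addr0; last first.
  move=> u /andP[/andP[vS wr]]; rewrite mem_index_iota => /andP[tu _].
  by rewrite (negbTE (late _ tu vS)) in wr.
rewrite opprB [X in _ + X]addrC addrACA subrr add0r.
rewrite big_mkcond mulr_sumr mulr_sumr -big_split/=.
have amax : (a <= maxn a (t - tau) <= t)%N.
  by rewrite leq_maxl geq_max at_ leq_subr.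
case/andP: amax => am mt; rewrite (big_cat_nat am mt)/= big1_seq ?add0r; last first.
  move=> u /andP[_]; rewrite mem_index_iota leq_max => /andP[au /orP[|ut]].
    by rewrite ltnNge au.
  case: ifPn => [_|]; first by rewrite mulNr addNr.
  have [vS|vS] := boolP (v \in supp fs (idx E u w)).
    by rewrite (early _ ut vS).
  by rewrite direction_supp// mulr0 addr0.
apply: eq_bigr => u _; have [vS|vS] := boolP (v \in supp fs (idx E u w)) => /=.
  by case: ifPn => _; rewrite ?mulNr ?addNr ?mulr0 ?mulr1 ?add0r.
by rewrite direction_supp// mul0r mulr0 addr0.
Qed.

End VirtualIterates.

(* Main.v *)
(* Fix an epoch with snapshot y and let g_t be the direction of iteration t.
   Expanding ||x_{t+1} - xstar||^2 along the virtual iterates and summing over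
   the epoch gives, with e_t the expected gap f - f(xstar) at xhat_t,
     2 gamma sum_t e_t <= E ||y - xstar||^2 + gamma^2 sum_t E ||g_t||^2
                          + 2 gamma sum_t E <g_t, xhat_t - x_t>,
   because g_t is conditionally unbiased and f is convex. The last sum consists
   of at most tau overlap terms <g_t, G g_u> per t. Since i_t is independent of
   g_u and g_t is supported in S_{i_t}, Young's inequality with weight
   sqrt Delta bounds each of them by sqrt Delta / 2 (E ||g_u||^2 + E ||g_t||^2).
   Finally E ||g_t||^2 <= 4 L (e_t + E f(y) - f(xstar)) by cocoercivity of the
   gradients, and ||y - xstar||^2 <= 2 / mu (f(y) - f(xstar)).
   The resulting contraction factor is at most theta: the summand tau mu gamma^2
   of theta is only slack here.

   The starting point is deterministic, the indices take finitely many values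
   and the inconsistencies are 0-1 masks, so every read vector takes finitely
   many values. Hence all expectations are those of simple random variables. *)

Require Import Defs.
From HB Require Import structures.
From mathcomp Require Import all_boot all_order all_algebra.
From mathcomp Require Import all_classical all_reals all_analysis.
From mathcomp Require Import ring lra zify.

Set Implicit Arguments.
Unset Strict Implicit.
Unset Printing Implicit Defensive.

Import Order.TTheory GRing.Theory Num.Theory.
Import numFieldNormedType.Exports.

Local Open Scope classical_set_scope.
Local Open Scope ring_scope.

(** * Euclidean geometry and smooth convex functions *)

(** Closes inequalities whose two sides [ring] or [field] can identify. *)
Lemma eq_ler (R : realType) (x y : R) : x = y -> x <= y.
Proof. by move=> ->. Qed.

Section DotProduct.
Context {R : realType} {d : nat}.
Implicit Types (x y z : 'rV[R]_d) (a : R).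

Definition dot x y : R := \sum_v x 0 v * y 0 v.

Lemma dotC x y : dot x y = dot y x.
Proof. by apply: eq_bigr => v _; rewrite mulrC. Qed.

Lemma dotDl x y z : dot (x + y) z = dot x z + dot y z.
Proof. by rewrite -big_split; apply: eq_bigr => v _; rewrite mxE mulrDl. Qed.

Lemma dotZl a x y : dot (a *: x) y = a * dot x y.
Proof. by rewrite mulr_sumr; apply: eq_bigr => v _; rewrite mxE mulrA. Qed.

Lemma dotNl x y : dot (- x) y = - dot x y.
Proof. by rewrite -scaleN1r dotZl mulN1r. Qed.

Lemma dotBl x y z : dot (x - y) z = dot x z - dot y z.
Proof. by rewrite dotDl dotNl. Qed.

Lemma dotDr x y z : dot x (y + z) = dot x y + dot x z.
Proof. by rewrite !(dotC x) dotDl. Qed.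

Lemma dotZr a x y : dot x (a *: y) = a * dot x y.
Proof. by rewrite !(dotC x) dotZl. Qed.

Lemma dotNr x y : dot x (- y) = - dot x y.
Proof. by rewrite !(dotC x) dotNl. Qed.

Lemma dotBr x y z : dot x (y - z) = dot x y - dot x z.
Proof. by rewrite !(dotC x) dotBl. Qed.

Lemma dot0l x : dot 0 x = 0.
Proof. by rewrite -(scale0r x) dotZl mul0r. Qed.

Lemma dot_suml (I : Type) (r : seq I) (Q : pred I) (F : I -> 'rV[R]_d) y :
  dot (\sum_(i <- r | Q i) F i) y = \sum_(i <- r | Q i) dot (F i) y.
Proof.
by apply: (big_morph (dot^~ y)) => [u v|]; rewrite ?dotDl ?dot0l.
Qed.

Lemma dot_sumr (I : Type) (r : seq I) (Q : pred I) (F : I -> 'rV[R]_d) x :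
  dot x (\sum_(i <- r | Q i) F i) = \sum_(i <- r | Q i) dot x (F i).
Proof. by rewrite dotC dot_suml; apply: eq_bigr => i _; rewrite dotC. Qed.

Definition dotE := (dotDl, dotBl, dotNl, dotZl, dotDr, dotBr, dotNr, dotZr).

Lemma dot_ge0 x : 0 <= dot x x.
Proof. by apply: sumr_ge0 => v _; rewrite -expr2 sqr_ge0. Qed.

Lemma dot_eq0 x : dot x x = 0 -> x = 0.
Proof.
move=> /eqP; rewrite psumr_eq0 => [/allP x0|v _]; last by rewrite -expr2 sqr_ge0.
apply/rowP => v; rewrite mxE; apply/eqP.
by have := x0 v (mem_index_enum _); rewrite mulf_eq0 orbb.
Qed.

Lemma enorm_sqr x : enorm x ^+ 2 = dot x x.
Proof.
rewrite sqr_sqrtr; last by apply: sumr_ge0 => v _; exact: sqr_ge0.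
by apply: eq_bigr => v _; rewrite expr2.
Qed.

Lemma dot_sub_sqr x y : dot (x - y) (x - y) = \sum_v (x 0 v - y 0 v) ^+ 2.
Proof. by apply: eq_bigr => v _; rewrite !mxE expr2. Qed.

Lemma enorm_ge0 x : 0 <= enorm x. Proof. exact: sqrtr_ge0. Qed.

(** Cauchy-Schwarz. The squared norm of [enorm y *: x - enorm x *: y] is [2 * (enorm x * enorm y)]
    times the gap between the two sides; the degenerate cases where this factor cannot be cancelled
    come first. *)
Lemma dot_le_enorm x y : dot x y <= enorm x * enorm y.
Proof.
have [y0|y0] := eqVneq (enorm y) 0.
  have -> : y = 0 by apply: dot_eq0; rewrite -enorm_sqr y0 expr0n.
  by rewrite dotC dot0l mulr_ge0 ?enorm_ge0.
have yp : 0 < enorm y by rewrite lt_def y0 enorm_ge0.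
have := dot_ge0 (enorm y *: x - enorm x *: y).
rewrite !dotE -!enorm_sqr (dotC y x) => h.
have [xy|xy] := leP (dot x y) 0.
  by apply: le_trans xy _; rewrite mulr_ge0 ?enorm_ge0.
have [x0|x0] := eqVneq (enorm x) 0.
  have xz : x = 0 by apply: dot_eq0; rewrite -enorm_sqr x0 expr0n.
  by rewrite xz dot0l ltxx in xy.
have xp : 0 < enorm x by rewrite lt_def x0 enorm_ge0.
rewrite -subr_ge0 -(@pmulr_rge0 _ (2 * (enorm x * enorm y))) ?mulr_gt0//.
by apply: le_trans h _; apply: eq_ler; ring.
Qed.

(** Young's inequality with weight [c] in each coordinate. Since [y] lives on [S], only the
    coordinates of [x] in [S] are charged; this is where sparsity enters. *)
Lemma sum_norm_mul_le (S : {set 'I_d}) (c : R) x y :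
  0 < c -> (forall v, v \notin S -> y 0 v = 0) ->
  \sum_v `|x 0 v| * `|y 0 v| <=
    (2 * c)^-1 * (\sum_(v in S) x 0 v ^+ 2) + c / 2 * dot y y.
Proof.
move=> c0 yS; rewrite (bigID (mem S))/= [X in _ + X]big1 ?addr0; last first.
  by move=> v /yS ->; rewrite normr0 mulr0.
apply: (@le_trans _ _ ((2 * c)^-1 * (\sum_(v in S) x 0 v ^+ 2) +
    c / 2 * \sum_(v in S) y 0 v ^+ 2)); last first.
  rewrite lerD2l ler_pM2l ?divr_gt0//.
  rewrite /dot [leRHS](bigID (mem S))/= (eq_bigr _ (fun v _ => expr2 (y 0 v))).
  by rewrite lerDl sumr_ge0// => v _; rewrite -expr2 sqr_ge0.
rewrite !mulr_sumr -big_split/=; apply: ler_sum => v _.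
rewrite -(real_normK (num_real (x 0 v))) -(real_normK (num_real (y 0 v))).
move: `|x 0 v| `|y 0 v| => a b.
rewrite -subr_ge0.
have -> : (2 * c)^-1 * a ^+ 2 + c / 2 * b ^+ 2 - a * b =
  (2 * c)^-1 * (a - c * b) ^+ 2 by field; rewrite gt_eqF.
by rewrite mulr_ge0 ?sqr_ge0// invr_ge0 mulr_ge0// ltW.
Qed.

End DotProduct.

(** * First-order inequalities for convex, strongly convex and smooth functions *)

Section Gradient.
Context {R : realType} {d : nat}.
Implicit Types (x y h : 'rV[R]_d) (g : 'rV[R]_d -> R) (s : R).

Lemma diff_dot_grad g x h : 'd g x h = dot (grad g x) h.
Proof.
rewrite [in LHS](matrix_sum_delta h) big_ord1 linear_sum; apply: eq_bigr => v _.
by rewrite linearZ mulrC /grad mxE.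
Qed.

Lemma is_derive_line g x h s : differentiable g (x + s *: h) ->
  is_derive s 1 (fun r => g (x + r *: h)) (dot (grad g (x + s *: h)) h).
Proof.
move=> dg; rewrite -diff_dot_grad -deriveE//.
(* The difference quotient of the restriction to the line is the one of [g] in direction [h], so
   derivability carries over. *)
have lineE : (fun r : R => r^-1 *: (((fun r => g (x + r *: h)) \o shift s) (r *: 1)
      - g (x + s *: h))) =
    (fun r : R => r^-1 *: ((g \o shift (x + s *: h)) (r *: h) - g (x + s *: h))).
  apply/funext => r /=; congr (_ *: (g _ - _)).
  by rewrite [r *: 1]mulr1 scalerDl addrCA.
have := @diff_derivable _ _ _ g _ h dg; rewrite /derivable => dgh.
by split; [rewrite /derivable lineE|rewrite /derive lineE].
Qed.

(** The right difference quotients at 0 are at most [c + q * a], and the second term vanishes in the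
    limit. Convexity, strong convexity and minimality all give bounds of this shape. *)
Lemma derive_le_quadratic (phi : R -> R) (D c q : R) : is_derive (0 : R) 1 phi D ->
  (forall a, 0 < a <= 1 -> phi a <= phi 0 + a * c + q * a ^+ 2) -> D <= c.
Proof.
move=> dphi phile.
have cvg_phi : (fun a : R => a^-1 *: (phi a - phi 0)) @ 0^'+ --> D.
  have := @ex_derive _ _ _ _ _ _ _ dphi; rewrite /derivable => /cvg_ex[l hl].
  have lD : l = D by rewrite -(derive_val (is_derive := dphi)); apply/esym/cvg_lim.
  rewrite lD in hl; apply: cvg_trans (cvg_dnbhs_at_right hl).
  by apply: near_eq_cvg; near=> a => /=; rewrite addr0 [a *: 1]mulr1.
have cvgc : (fun a : R => c + q * a) @ 0^'+ --> c.
  apply: cvg_at_right_filter; rewrite -[X in _ --> X]addr0 -[X in _ + X](mulr0 q).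
  by apply: cvgD; [exact: cvg_cst|apply: cvgM; [exact: cvg_cst|exact: cvg_id]].
apply: (ler_cvg_to cvg_phi cvgc); near=> a.
have a0 : 0 < a by near: a; exact: nbhs_right_gt.
have a1 : a <= 1 by near: a; apply: nbhs_right_le.
rewrite [_ *: _]mulrC ler_pdivrMr// lerBlDl (le_trans (phile a _)) ?a0//.
by apply: eq_ler; ring.
Unshelve. all: by end_near. Qed.

(** Covers plain convexity with [q = 0] and strong convexity with
    [q = mu / 2 * dot (y - x) (y - x)]: on the segment from [x] to [y] the assumed bound is a
    quadratic in [a] with slope [g y - g x - q] at 0. *)
Lemma grad_le_of_convex g x y (q : R) : differentiable g x ->
  (forall a, 0 < a <= 1 ->
    g (a *: y + (1 - a) *: x) <= a * g y + (1 - a) * g x - q * a * (1 - a)) ->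
  g x + dot (grad g x) (y - x) + q <= g y.
Proof.
move=> dg gle; rewrite -addrA -lerBrDl -lerBrDr.
have dl : is_derive (0 : R) 1 (fun r => g (x + r *: (y - x)))
    (dot (grad g x) (y - x)).
  by rewrite -[in grad g x](addr0 x) -(scale0r (y - x));
     apply: is_derive_line; rewrite scale0r addr0.
apply: (derive_le_quadratic (q := q) dl) => a a01.
rewrite scale0r addr0 [leLHS](_ : _ = g (a *: y + (1 - a) *: x)); last first.
  by congr g; rewrite scalerBr scalerBl scale1r addrCA addrA.
by apply: le_trans (gle a a01) _; apply: eq_ler; ring.
Qed.

Lemma convex_grad_le g x y : convex_function setT g -> differentiable g x ->
  g x + dot (grad g x) (y - x) <= g y.
Proof.
move=> cg dg; rewrite -[leLHS]addr0; apply: grad_le_of_convex dg _ => a /andP[a0 a1].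
rewrite !mul0r subr0.
have a01 : 0 <= a <= 1 by rewrite ltW.
have := cg (Itv01 (ltW a0) a1) y x; rewrite !inE => /(_ I I).
by [].
Qed.

Lemma strongly_convex_grad_le mu g x y : strongly_convex mu g ->
  differentiable g x ->
  g x + dot (grad g x) (y - x) + mu / 2 * dot (y - x) (y - x) <= g y.
Proof.
move=> sg dg; apply: grad_le_of_convex dg _ => a /andP[a0 a1].
have := sg y x a; rewrite (ltW a0) a1 => /(_ isT) /le_trans; apply.
by rewrite enorm_sqr le_eqVlt; apply/orP; left; apply/eqP; ring.
Qed.

(** Along the direction [- grad g x] the derivative is minus the squared norm of the gradient, while
    minimality forbids a negative slope. *)
Lemma grad_min_eq0 g x : differentiable g x -> (forall y, g x <= g y) ->
  grad g x = 0.
Proof.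
move=> dg gmin; apply: dot_eq0; apply/eqP; rewrite eq_le dot_ge0 andbT.
have dl : is_derive (0 : R) 1 (fun r => g (x + r *: (- grad g x)))
    (dot (grad g x) (- grad g x)).
  by rewrite -[in X in dot X _](addr0 x) -(scale0r (- grad g x));
     apply: is_derive_line; rewrite scale0r addr0.
have dN := is_deriveN dl.
rewrite -[leLHS]opprK -dotNr.
apply: (derive_le_quadratic (q := 0) dN) => a _.
by rewrite mulr0 mul0r !addr0 lerN2 scale0r addr0.
Qed.

(** Let [phi] be [g] along the segment minus its linear part and the quadratic term. By
    Cauchy-Schwarz and the Lipschitz bound its derivative [dphi] is nonpositive on [0,1], so the
    mean value theorem gives [phi 1 <= phi 0]. *)
Lemma descent_lemma L g x h : (forall y, differentiable g y) ->
  lipschitz_grad L g -> g (x + h) <= g x + dot (grad g x) h + L / 2 * dot h h.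
Proof.
move=> dg lg.
pose phi (s : R) := g (x + s *: h) - s * dot (grad g x) h - L / 2 * dot h h * s ^+ 2.
pose dphi (s : R) := dot (grad g (x + s *: h)) h - dot (grad g x) h
  - L * dot h h * s.
have phiD (s : R) : is_derive s 1 phi (dphi s).
  have D1 := is_derive_line (dg (x + s *: h)).
  have D2 : is_derive s 1 (dot (grad g x) h \*: (id : R -> R)) (dot (grad g x) h *: 1).
    exact: is_deriveZ.
  have D3 : is_derive s 1 ((L / 2 * dot h h) \*: ((id : R -> R) ^+ 2))
     ((L / 2 * dot h h) *: ((2%:R * s ^+ 1) *: 1)).
    by apply: is_deriveZ; exact: is_deriveX.
  have := is_deriveB (is_deriveB D1 D2) D3.
  have -> : (fun r => g (x + r *: h)) - dot (grad g x) h \*: (id : R -> R) -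
      (L / 2 * dot h h) \*: ((id : R -> R) ^+ 2) = phi.
    by apply/funext => r; rewrite /phi (mulrC r).
  move=> /is_derive_eq; apply; rewrite /dphi; congr (_ - _ - _).
    exact: mulr1.
  rewrite -[LHS]/(_ * (_ * 1)) expr1; by field.
have [|c c01] := @MVT_segment _ phi dphi 0 1 ler01 (fun (s : R) _ => phiD s).
  apply: derivable_within_continuous => s _; exact: ex_derive.
move: c01; rewrite in_itv/= => /andP[c0 c1].
rewrite subr0 mulr1 /phi !scale0r !scale1r addr0 => e.
suff : dphi c <= 0 by move: e; rewrite expr0n expr1n/=; lra.
rewrite /dphi -dotBl subr_le0 (le_trans (dot_le_enorm _ _))//.
rewrite -enorm_sqr expr2 (le_trans (ler_wpM2r (enorm_ge0 _) (lg _ _)))//.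
rewrite addrAC subrr add0r.
have -> : enorm (c *: h) = c * enorm h.
  apply/eqP; rewrite -(@eqrXn2 _ 2) ?mulr_ge0 ?enorm_ge0//.
  by rewrite exprMn !enorm_sqr !dotE mulrA expr2.
by apply: eq_ler; ring.
Qed.

(** The algebra of cocoercivity. Here [a], [b], [c] stand for the values of [g] at [x], at the point
    after the step and at [y]; [p] and [q] are the gradients at [x] and [y], and [u] is [x - y]. *)
Lemma gradient_step_bound (a b c L : R) (p q u : 'rV[R]_d) : 0 < L ->
  b <= a + dot p (- L^-1 *: (p - q)) +
    L / 2 * dot (- L^-1 *: (p - q)) (- L^-1 *: (p - q)) ->
  c + dot q (u + - L^-1 *: (p - q)) <= b ->
  dot (p - q) (p - q) <= 2 * L * (a - c - dot q u).
Proof.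
move=> Lp h1 h2; have := le_trans h2 h1.
rewrite !dotE (dotC q p) -subr_ge0 => h3.
rewrite -ler_pdivrMl ?mulr_gt0//.
rewrite -subr_ge0; apply: le_trans h3 _.
by apply: eq_ler; field; rewrite gt_eqF.
Qed.

Lemma grad_cocoercive L g x y : 0 <= L -> convex_function setT g ->
  (forall z, differentiable g z) -> lipschitz_grad L g ->
  dot (grad g x - grad g y) (grad g x - grad g y) <=
    2 * L * (g x - g y - dot (grad g y) (x - y)).
Proof.
(* The step length is the inverse of [L], so [L = 0] is treated apart: the gradient is then
   constant. *)
move=> L0 cg dg lg; have [L00|Lp] := eqVneq L 0.
  rewrite -enorm_sqr L00 mulr0 mul0r.
  have := lg x y; rewrite L00 mul0r => e0.
  by have /eqP -> : enorm (grad g x - grad g y) == 0;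
    rewrite ?expr0n// eq_le e0 enorm_ge0.
have {}Lp : 0 < L by rewrite lt_def Lp.
(* A gradient step from [x] for [g] minus its linearization at [y]: smoothness bounds [g (x + z)]
   above, convexity at [y] bounds it below. *)
set z := - L^-1 *: (grad g x - grad g y).
have := @convex_grad_le _ y (x + z) cg (dg y).
have -> : x + z - y = x - y + z by rewrite addrAC.
by apply: gradient_step_bound => //; exact: descent_lemma.
Qed.

End Gradient.

(** * The SVRG estimator *)

Section SVRG.
Context {R : realType} {d n : nat}.
Variable fs : 'I_n -> 'rV[R]_d -> R.
Hypothesis n_gt0 : (0 < n)%N.
Hypothesis fs_diff : forall i x, differentiable (fs i) x.
Implicit Types (x y : 'rV[R]_d) (v : 'I_d) (i : 'I_n).

Let n_neq0 : n%:R != 0 :> R. Proof. by rewrite pnatr_eq0 -lt0n. Qed.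

Let avg_sumE : avg fs = n%:R^-1 \*: \sum_i fs i.
Proof. by apply/funext => x; rewrite /= fct_sumE. Qed.

Lemma differentiable_avg x : differentiable (avg fs) x.
Proof.
by rewrite avg_sumE; apply: differentiableZ; exact: differentiable_sum.
Qed.

Lemma grad_avg x v : grad (avg fs) x 0 v = n%:R^-1 * \sum_i grad (fs i) x 0 v.
Proof.
rewrite mxE -deriveE; last exact: differentiable_avg.
have H i : is_derive x (delta_mx 0 v) (fs i) (grad (fs i) x 0 v).
  rewrite mxE -deriveE; last exact: fs_diff.
  by apply: derivableP; exact: diff_derivable.
have S := is_deriveZ n%:R^-1 (is_derive_sum H).
by rewrite avg_sumE (derive_val (is_derive := S)).
Qed.

Lemma grad_supp i x v : v \notin supp fs i -> grad (fs i) x 0 v = 0.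
Proof.
rewrite inE => vS; apply: contrapT => g0; move/negP: vS; apply.
by apply/asboolP; exists x.
Qed.

Lemma coord_freqE v : coord_freq fs v = n%:R^-1 * \sum_i (v \in supp fs i)%:R.
Proof.
rewrite /coord_freq /coord_count -sum1_card natr_sum big_mkcond/=.
by congr (_ * _); apply: eq_bigr => i _; rewrite inE; case: (_ \in _).
Qed.

Lemma coord_freq_le_sparsity v : coord_freq fs v <= sparsity fs.
Proof.
rewrite /coord_freq /sparsity ler_wpM2l ?invr_ge0//.
by rewrite ler_nat leq_bigmax.
Qed.

Lemma coord_freq_eq0 v i : coord_freq fs v = 0 -> v \notin supp fs i.
Proof.
move=> /eqP; rewrite mulf_eq0 invr_eq0 (negbTE n_neq0)/= pnatr_eq0 cards_eq0.
by move=> /eqP /setP /(_ i); rewrite !inE => ->.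
Qed.

Lemma sparsity_ge0 : 0 <= sparsity fs.
Proof. by rewrite mulr_ge0 ?invr_ge0. Qed.

Lemma svrg_directionE i x y v : svrg_direction fs i x y 0 v =
  grad (fs i) x 0 v - grad (fs i) y 0 v +
  grad (avg fs) y 0 v / coord_freq fs v * (v \in supp fs i)%:R.
Proof.
rewrite /svrg_direction /Di_mx /coord_proj_mx /D_mx mulmxA.
have subaddE (A B C : 'rV[R]_d) : (A - B + C) 0 v = A 0 v - B 0 v + C 0 v.
  by rewrite !mxE.
have diagE (A : 'rV[R]_d) (b : 'rV[R]_d) : (A *m diag_mx b) 0 v = A 0 v * b 0 v.
  by rewrite mul_mx_diag mxE.
have rowE (F : 'I_d -> R) : (\row_w F w) 0 v = F v by rewrite mxE.
move: (grad (fs i) x) (grad (fs i) y) (grad (avg fs) y) => A B C.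
by rewrite subaddE 2!diagE 2!rowE mulrAC.
Qed.

(** The weights 1/p_v of [D_mx] undo the masking: the indicator of the support averages to p_v. Here
    [b] and [g] are coordinate [v] of the component gradients and of the full gradient. *)
Lemma avg_correction (b : 'I_n -> R) (g : R) v :
  (forall i, v \notin supp fs i -> b i = 0) -> n%:R^-1 * \sum_i b i = g ->
  n%:R^-1 * \sum_i (g / coord_freq fs v * (v \in supp fs i)%:R) = g.
Proof.
move=> b0 bg; rewrite -mulr_sumr mulrCA -coord_freqE.
(* If p_v = 0, no support contains [v]; then every [b i] is 0, hence so is [g]. *)
have [p0|p0] := eqVneq (coord_freq fs v) 0; last by rewrite mulfVK.
rewrite p0 mulr0 -bg big1 ?mulr0// => i _.
by rewrite b0// coord_freq_eq0.
Qed.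

Lemma avg_corrected (a b : 'I_n -> R) (ga gb : R) v :
  (forall i, v \notin supp fs i -> b i = 0) ->
  n%:R^-1 * \sum_i a i = ga -> n%:R^-1 * \sum_i b i = gb ->
  n%:R^-1 * \sum_i (a i - b i + gb / coord_freq fs v * (v \in supp fs i)%:R) = ga.
Proof.
move=> b0 aE bE; rewrite big_split sumrB mulrDr mulrBr aE bE.
by rewrite (avg_correction b0 bE) subrK.
Qed.

Lemma svrg_direction_unbiased x y :
  n%:R^-1 *: \sum_i svrg_direction fs i x y = grad (avg fs) x.
Proof.
apply/rowP => v; rewrite mxE summxE.
under eq_bigr do rewrite svrg_directionE.
by apply: avg_corrected => [i||]; [exact: grad_supp|rewrite grad_avg..].
Qed.

(** In use, [a], [b], [s] are coordinate [v] of the component gradients at the read vector, the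
    snapshot and the minimizer. With [c] the correction, split the term as [(a - s) - (b - s - c)]
    and use (t - u)^2 <= 2 t^2 + 2 u^2; subtracting [c] does not increase the sum of squares, as for
    a variance. *)
Lemma sum_corrected_sqr (a b s : 'I_n -> R) (g : R) v :
  (forall i, v \notin supp fs i -> b i = 0) ->
  (forall i, v \notin supp fs i -> s i = 0) ->
  n%:R^-1 * \sum_i b i = g -> n%:R^-1 * \sum_i s i = 0 ->
  \sum_i (a i - b i + g / coord_freq fs v * (v \in supp fs i)%:R) ^+ 2 <=
  2 * (\sum_i (a i - s i) ^+ 2) + 2 * (\sum_i (b i - s i) ^+ 2).
Proof.
move=> b0 s0 bg sg; set q := g / _.
pose c i : R := q * (v \in supp fs i)%:R.
have cg : n%:R^-1 * \sum_i c i = g := avg_correction b0 bg.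
have corr : \sum_i (b i - s i - c i) ^+ 2 <= \sum_i (b i - s i) ^+ 2.
  rewrite -subr_ge0 -sumrB.
  (* On the support [c i = q]; off it [b i], [s i] and [c i] all vanish. The average of this
     expression is then [q * g], that is g^2 / p_v. *)
  rewrite (eq_bigr (fun i => 2 * q * (b i - s i) - q * c i)); last first.
    move=> i _; rewrite /c; have [vS|vS] := boolP (v \in supp fs i).
      by rewrite mulr1n; ring.
    by rewrite b0// s0// mulr0n; ring.
  have sumE : n%:R^-1 * (\sum_i (2 * q * (b i - s i) - q * c i)) = 2 * q * g - q * g.
    rewrite sumrB -mulr_sumr -[X in _ - X]mulr_sumr mulrBr [X in X - _]mulrCA.
    by rewrite sumrB [X in _ * X - _]mulrBr bg sg subr0 [X in _ - X]mulrCA cg.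
  rewrite -(pmulr_rge0 _ (_ : 0 < n%:R^-1)) ?invr_gt0 ?ltr0n// sumE.
  have -> : 2 * q * g - q * g = g ^+ 2 / coord_freq fs v by rewrite /q; ring.
  by rewrite divr_ge0 ?sqr_ge0// mulr_ge0 ?invr_ge0.
apply: le_trans (_ : _ <= 2 * (\sum_i (a i - s i) ^+ 2) +
    2 * (\sum_i (b i - s i - c i) ^+ 2)) _; last by rewrite lerD2l ler_pM2l.
rewrite !mulr_sumr -big_split/=; apply: ler_sum => i _; rewrite -/(c i).
have -> : a i - b i + c i = (a i - s i) - (b i - s i - c i) by ring.
have := sqr_ge0 ((a i - s i) + (b i - s i - c i)).
move: (a i - s i) (b i - s i - c i) => t u h; rewrite -subr_ge0.
by apply: le_trans h _; apply: eq_ler; ring.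
Qed.

Variables (L : R) (xstar : 'rV[R]_d).
Hypothesis L_ge0 : 0 <= L.
Hypothesis fs_convex : forall i, convex_function setT (fs i).
Hypothesis fs_lip : forall i, lipschitz_grad L (fs i).
Hypothesis xstar_min : forall x, avg fs xstar <= avg fs x.

Lemma grad_avg_min : grad (avg fs) xstar = 0.
Proof. by apply: grad_min_eq0 xstar_min; exact: differentiable_avg. Qed.

Lemma avg_grad_min v : n%:R^-1 * \sum_i grad (fs i) xstar 0 v = 0.
Proof. by rewrite -grad_avg grad_avg_min mxE. Qed.

(** Cocoercivity of each component, averaged. The linear terms cancel because the component
    gradients at [xstar] average to zero. *)
Lemma sum_grad_sub_sqr x :
  n%:R^-1 * (\sum_i \sum_v (grad (fs i) x 0 v - grad (fs i) xstar 0 v) ^+ 2) <=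
  2 * L * (avg fs x - avg fs xstar).
Proof.
have bregman : avg fs x - avg fs xstar =
    n%:R^-1 * \sum_i (fs i x - fs i xstar - dot (grad (fs i) xstar) (x - xstar)).
  rewrite !sumrB -dot_suml !mulrBr -dotZl.
  suff -> : n%:R^-1 *: \sum_i grad (fs i) xstar = 0 by rewrite dot0l subr0.
  by apply/rowP => v; rewrite mxE summxE avg_grad_min mxE.
rewrite bregman [leRHS]mulrCA ler_wpM2l ?invr_ge0// mulr_sumr.
apply: ler_sum => i _.
have := grad_cocoercive x xstar L_ge0 (fs_convex i) (fs_diff i) (fs_lip i).
by rewrite dot_sub_sqr.
Qed.

(** Sum [sum_corrected_sqr] over the coordinates, then bound both halves by [sum_grad_sub_sqr]; the
    factor 4 is 2 from splitting times 2 from cocoercivity. *)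
Lemma svrg_direction_second_moment x y :
  n%:R^-1 * (\sum_i dot (svrg_direction fs i x y) (svrg_direction fs i x y)) <=
  4 * L * (avg fs x - avg fs xstar + (avg fs y - avg fs xstar)).
Proof.
have split_sqr : \sum_i dot (svrg_direction fs i x y) (svrg_direction fs i x y) <=
    2 * (\sum_i \sum_v (grad (fs i) x 0 v - grad (fs i) xstar 0 v) ^+ 2) +
    2 * (\sum_i \sum_v (grad (fs i) y 0 v - grad (fs i) xstar 0 v) ^+ 2).
  have exch (A B : 'I_n -> 'I_d -> R) :
      2 * (\sum_i \sum_v A i v) + 2 * (\sum_i \sum_v B i v) =
      \sum_v (2 * (\sum_i A i v) + 2 * (\sum_i B i v)).
    by rewrite (exchange_big _ _ _ _ _ A) (exchange_big _ _ _ _ _ B) big_split -!mulr_sumr.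
  rewrite exch exchange_big; apply: ler_sum => v _.
  under eq_bigr do rewrite svrg_directionE -expr2.
  apply: sum_corrected_sqr.
  - by move=> i; exact: grad_supp.
  - by move=> i; exact: grad_supp.
  - exact: esym (grad_avg y v).
  - exact: avg_grad_min.
have n0 : 0 <= n%:R^-1 :> R by rewrite invr_ge0.
apply: le_trans (ler_wpM2l n0 split_sqr) _.
rewrite mulrDr [X in X + _]mulrCA [X in _ + X]mulrCA.
have two_ge0 : 0 <= 2 :> R by [].
apply: le_trans (lerD (ler_wpM2l two_ge0 (sum_grad_sub_sqr x))
                      (ler_wpM2l two_ge0 (sum_grad_sub_sqr y))) _.
by apply: eq_ler; ring.
Qed.

End SVRG.

(** * Simple random variables *)

Section SimpleRandomVariables.
Context {disp : measure_display} {Omega : measurableType disp}.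
Implicit Types (F : set (set Omega)).

(** Stated through fibres for an arbitrary family [F], so that one notion serves all measurable
    sets, a history, or the power set, where it only says that the range is finite. [T] carries no
    structure, so vectors and pairs fit too. *)
Definition simple_rv F (T : Type) (X : Omega -> T) : Prop :=
  finite_set (range X) /\ forall a, F (X @^-1` [set a]).

Lemma sigma_algebra_fin_bigcup F (I : Type) (D : set I) (A : I -> set Omega) :
  sigma_algebra setT F -> finite_set D -> (forall i, D i -> F (A i)) ->
  F (\bigcup_(i in D) A i).
Proof.
(* Seen as the sigma-algebra generated by itself, [F] becomes the measurable sets of a type, to
   which the closure lemmas apply. *)
move=> sF fD FA; rewrite -(sigma_algebra_id sF).
apply: (@fin_bigcup_measurable _ (g_sigma_algebraType F)) => // i Di.
by apply: sub_sigma_algebra; exact: FA.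
Qed.

Lemma sigma_algebra_fin_bigcap F (I : Type) (D : set I) (A : I -> set Omega) :
  sigma_algebra setT F -> finite_set D -> (forall i, D i -> F (A i)) ->
  F (\bigcap_(i in D) A i).
Proof.
move=> sF fD FA; rewrite -(sigma_algebra_id sF).
apply: (@fin_bigcap_measurable _ (g_sigma_algebraType F)) => // i Di.
by apply: sub_sigma_algebra; exact: FA.
Qed.

Lemma sigma_algebra_setI F (A B : set Omega) : sigma_algebra setT F ->
  F A -> F B -> F (A `&` B).
Proof.
move=> sF FA FB; have : setI_closed F.
  by have [] := (sigma_algebraP (fun X _ => subsetT X)).1 sF.
exact.
Qed.

Variable F : set (set Omega).
Hypothesis sF : sigma_algebra setT F.

(** A fibre of the composite is a finite union of fibres of [X], whatever the map [phi] is. *)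
Lemma simple_comp (T U : Type) (phi : T -> U) (X : Omega -> T) :
  simple_rv F X -> simple_rv F (fun w => phi (X w)).
Proof.
move=> [fX mX]; split.
  apply: (@sub_finite_set _ _ (phi @` range X)); last exact: finite_image.
  by move=> _ [w _ <-]; exists (X w) => //; exists w.
move=> b; rewrite [X in F X](_ : _ =
    \bigcup_(a in range X `&` phi @^-1` [set b]) (X @^-1` [set a])).
  by apply: sigma_algebra_fin_bigcup => //; exact: finite_setIl.
apply/seteqP; split => w /=; first by move=> Xb; exists (X w) => //; split => //; exists w.
by move=> [a [_ <-] ->].
Qed.

Lemma simple_pair (T U : Type) (X : Omega -> T) (Y : Omega -> U) :
  simple_rv F X -> simple_rv F Y -> simple_rv F (fun w => (X w, Y w)).
Proof.
move=> [fX mX] [fY mY]; split.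
  apply: (@sub_finite_set _ _ (range X `*` range Y)); last exact: finite_setX.
  by move=> _ [w _ <-]; split; exists w.
move=> [a b]; rewrite [X in F X](_ : _ = X @^-1` [set a] `&` Y @^-1` [set b]).
  exact: sigma_algebra_setI.
by apply/seteqP; split => w /= [-> ->].
Qed.

Lemma simple_comp2 (T U V : Type) (phi : T -> U -> V) (X : Omega -> T)
    (Y : Omega -> U) :
  simple_rv F X -> simple_rv F Y -> simple_rv F (fun w => phi (X w) (Y w)).
Proof.
by move=> sX sY; exact: (simple_comp (fun p => phi p.1 p.2) (simple_pair sX sY)).
Qed.

Lemma simple_cst (T : Type) (a : T) : simple_rv F (fun=> a).
Proof.
split.
  apply: (@sub_finite_set _ _ [set a]); last exact: finite_set1.
  by move=> _ [w _ <-].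
move=> b; rewrite preimage_cst; case: ifP => _; last by case: sF.
by have [] := (sigma_algebraP (fun X _ => subsetT X)).1 sF.
Qed.

Lemma simple_finType (T : finType) (X : Omega -> T) :
  (forall j, F (X @^-1` [set j])) -> simple_rv F X.
Proof. by move=> mX; split. Qed.

(** Handles a random choice among finitely many variables, such as the next snapshot, by cutting
    along the values of the selector. *)
Lemma simple_select (T : finType) (U : Type) (X : Omega -> T)
    (Y : T -> Omega -> U) :
  simple_rv F X -> (forall j, simple_rv F (Y j)) ->
  simple_rv F (fun w => Y (X w) w).
Proof.
move=> [fX mX] sY; split.
  apply: (@sub_finite_set _ _ (\bigcup_(j in range X) range (Y j))).
    by move=> _ [w _ <-]; exists (X w); [exists w|exists w].
  by apply: bigcup_finite => // j _; have [] := sY j.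
move=> b; rewrite [X in F X](_ : _ =
    \bigcup_(j in range X) (X @^-1` [set j] `&` Y j @^-1` [set b])).
  apply: sigma_algebra_fin_bigcup => // j _.
  by apply: sigma_algebra_setI => //; have [] := sY j.
apply/seteqP; split => w /=; first by move=> Yb; exists (X w) => //; exists w.
by move=> [j _ [/= -> ]].
Qed.

Lemma simple_row (R : Type) (d : nat) (X : Omega -> 'rV[R]_d) :
  finite_set (range X) ->
  (forall v r, F ((fun w => X w 0 v) @^-1` [set r])) -> simple_rv F X.
Proof.
move=> fX mX; split=> // a.
rewrite [X in F X](_ : _ =
    \bigcap_(v in [set: 'I_d]) ((fun w => X w 0 v) @^-1` [set a 0 v])).
  by apply: sigma_algebra_fin_bigcap.
apply/seteqP; split => w /=; first by move=> Xa v _; rewrite /= Xa.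
by move=> h; apply/rowP => v; exact: h.
Qed.

Lemma simple_sum (V : nmodType) (I : Type) (r : seq I) (Q : pred I)
    (X : I -> Omega -> V) :
  (forall i, Q i -> simple_rv F (X i)) ->
  simple_rv F (fun w => \sum_(i <- r | Q i) X i w).
Proof.
move=> sX; elim: r => [|i r IHr].
  by under eq_fun do rewrite big_nil; exact: simple_cst.
under eq_fun do rewrite big_cons.
case: (boolP (Q i)) => // Qi; apply: (simple_comp2 (fun x y : V => x + y)) => //.
exact: sX.
Qed.

End SimpleRandomVariables.

(** * Expectations of simple random variables *)

Section Expectation.
Context {disp : measure_display} {Omega : measurableType disp} {R : realType}.
Variable P : probability Omega R.
Local Notation simple := (simple_rv (@measurable disp Omega)).
Local Notation EX X := (Rintegral P setT X).
Implicit Types (X Y : Omega -> R).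

Let sM := sigma_algebra_measurable Omega.

Lemma simple_measurable_fun X : simple X -> measurable_fun setT X.
Proof.
move=> [fX mX] _ B mB; rewrite setTI.
rewrite [X in measurable X](_ : _ = \bigcup_(a in range X `&` B) (X @^-1` [set a])).
  by apply: fin_bigcup_measurable; [exact: finite_setIl|move=> a _].
apply/seteqP; split => w /=; first by move=> Xb; exists (X w) => //; split => //; exists w.
by move=> [a [_ Ba] Xa]; rewrite Xa.
Qed.

Lemma simple_integrable X : simple X -> P.-integrable setT (EFin \o X).
Proof.
move=> sX; apply: measurable_bounded_integrable => //.
- by rewrite -ge0_fin_numE// fin_num_measure.
- exact: simple_measurable_fun.
have [/finite_seqP[s sE] _] := sX.
(* The sum of the absolute values of all attained values dominates each of them. *)
exists (\sum_(a <- s) `|a|); split; first by apply: num_real.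
move=> M sM' w _ /=; apply: le_trans (ltW sM').
have : X w \in s by suff : [set` s] (X w) by []; rewrite -sE; exists w.
move=> /(big_rem _) -> /=.
by rewrite lerDl sumr_ge0.
Qed.

(** Lets the whole argument run with real-valued integrals. *)
Lemma expectation_Rintegral X : simple X -> ('E_P[X] = (EX X)%:E)%E.
Proof.
move=> sX; rewrite unlock /Rintegral fineK//.
exact: integrable_fin_num (simple_integrable sX).
Qed.

Lemma Ex_cst (c : R) : EX (fun=> c) = c.
Proof.
transitivity (c * fine (P setT)); first exact: Rintegral_cst.
by rewrite probability_setT mulr1.
Qed.

Lemma Ex_D X Y : simple X -> simple Y -> EX (fun w => X w + Y w) = EX X + EX Y.
Proof. by move=> sX sY; rewrite RintegralD//; exact: simple_integrable. Qed.

Lemma Ex_Z (c : R) X : simple X -> EX (fun w => c * X w) = c * EX X.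
Proof. by move=> sX; rewrite RintegralZl//; exact: simple_integrable. Qed.

Lemma Ex_B X Y : simple X -> simple Y -> EX (fun w => X w - Y w) = EX X - EX Y.
Proof. by move=> sX sY; rewrite RintegralB//; exact: simple_integrable. Qed.

Lemma le_Ex X Y : simple X -> simple Y -> (forall w, X w <= Y w) -> EX X <= EX Y.
Proof. by move=> sX sY XY; apply: le_Rintegral => //; exact: simple_integrable. Qed.

Lemma Ex_sum (I : Type) (r : seq I) (Q : pred I) (X : I -> Omega -> R) :
  (forall i, Q i -> simple (X i)) ->
  EX (fun w => \sum_(i <- r | Q i) X i w) = \sum_(i <- r | Q i) EX (X i).
Proof.
move=> sX; elim: r => [|i r IHr].
  by rewrite big_nil; under eq_Rintegral do rewrite big_nil; exact: Ex_cst.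
rewrite big_cons; under eq_Rintegral do rewrite big_cons.
case: ifP => // Qi; rewrite Ex_D ?IHr//; first exact: sX.
exact: simple_sum.
Qed.

Lemma simple_indic (A : set Omega) : measurable A -> simple (\1_A : Omega -> R).
Proof.
move=> mA; apply: (simple_comp sM (fun b : bool => b%:R) (X := fun w => w \in A)).
apply: simple_finType => -[]; last first.
  rewrite [X in measurable X](_ : _ = ~` A); first exact: measurableC.
  apply/seteqP; split => w /=; first by move=> /negbT; rewrite notin_setE.
  by move=> Aw; apply/negbTE; rewrite notin_setE.
rewrite [X in measurable X](_ : _ = A)//.
by apply/seteqP; split => w /=; [move=> /set_mem|move=> /mem_set].
Qed.

Lemma Ex_indic (A : set Omega) : measurable A -> EX (\1_A) = fine (P A).
Proof. by move=> mA; rewrite /Rintegral integral_indic// setIT. Qed.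

Lemma mul_indic (A B : set Omega) w :
  \1_(A `&` B) w = \1_A w * \1_B w :> R.
Proof. by rewrite !indicE in_setI -natrM mulnb. Qed.

Lemma simple_decomp X (s : seq R) w : range X = [set` s] -> uniq s ->
  X w = \sum_(a <- s) a * \1_(X @^-1` [set a]) w.
Proof.
move=> sE us; have Xs : X w \in s by suff : [set` s] (X w) by []; rewrite -sE; exists w.
rewrite (big_rem (X w))//= indicE mem_set// mulr1 big_seq big1 ?addr0// => a.
rewrite mem_rem_uniq// inE => /andP[aX _]; rewrite indicE memNset ?mulr0//=.
by move=> h; rewrite -h eqxx in aX.
Qed.

(** * Averaging over an independent uniform index *)

Section Independence.
Variables (F : set (set Omega)) (T : finType) (X : Omega -> T).
Hypothesis FM : F `<=` @measurable disp Omega.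
Hypothesis mX : discrete_rv X.
Hypothesis uX : uniform_rv P X.
Hypothesis iX : independent_of P X F.

(** [Y] is a finite combination of indicators of its level sets, which lie in [F]; on each of them
    the product rule is the assumed independence. *)
Lemma Ex_mul_indic Y j : simple_rv F Y ->
  EX (fun w => \1_(X @^-1` [set j]) w * Y w) = #|T|%:R^-1 * EX Y.
Proof.
move=> [fY FY]; have sY : simple Y by split=> // a; exact/FM.
have /finite_seqP[s' sE'] := fY.
have [s us sE] : exists2 s, uniq s & range Y = [set` s].
  exists (undup s'); first exact: undup_uniq.
  by rewrite sE'; apply/seteqP; split => a /=; rewrite mem_undup.
have mYX a : measurable (X @^-1` [set j] `&` Y @^-1` [set a]).
  by apply: measurableI; [exact: mX|exact/FM].
under eq_Rintegral => w _.
  rewrite (simple_decomp w sE us) mulr_sumr.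
  under eq_bigr => a _ do rewrite mulrCA -(mul_indic _ _ w).
  over.
rewrite Ex_sum; last first.
  move=> a _; apply: (simple_comp2 sM (fun x y : R => x * y)).
    exact: simple_cst.
  exact: simple_indic.
have -> : EX Y = EX (fun w => \sum_(a <- s) a * \1_(Y @^-1` [set a]) w).
  by apply: eq_Rintegral => w _; exact: simple_decomp.
rewrite Ex_sum; last first.
  move=> a _; apply: (simple_comp2 sM (fun x y : R => x * y)).
    exact: simple_cst.
  by apply: simple_indic; exact/FM.
rewrite mulr_sumr; apply: eq_bigr => a _.
rewrite (Ex_Z a (simple_indic (mYX a))).
rewrite (Ex_Z a (simple_indic (FM (FY a)))).
rewrite !Ex_indic//; last exact/FM.
rewrite setIC iX// uX fineM// ?fin_num_measure//; last exact/FM.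
by rewrite [RHS]mulrCA; congr (_ * _); rewrite [LHS]mulrC.
Qed.

(** Takes the place of conditional expectation given [F]: the index is frozen to each [j] and the
    results are averaged. *)
Lemma Ex_uniform_select (Y : T -> Omega -> R) :
  (forall j, simple_rv F (Y j)) ->
  EX (fun w => Y (X w) w) = #|T|%:R^-1 * \sum_j EX (Y j).
Proof.
move=> sY; under eq_Rintegral => w _.
  rewrite (_ : Y (X w) w = \sum_j \1_(X @^-1` [set j]) w * Y j w); last first.
    rewrite (bigD1 (X w))//= indicE mem_set// mul1r big1 ?addr0// => j jX.
    by rewrite indicE memNset ?mul0r//= => h; rewrite h eqxx in jX.
  over.
rewrite Ex_sum; first by rewrite mulr_sumr; apply: eq_bigr => j _; exact: Ex_mul_indic.
move=> j _; apply: (simple_comp2 sM (fun x y : R => x * y)).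
  by apply: simple_indic; exact: mX.
by have [fY FY] := sY j; split=> // a; exact/FM.
Qed.

End Independence.
End Expectation.

(** * One epoch *)

Section Windows.
Context {R : realType}.

Lemma sum_window_const (a b c tau : nat) (Q : pred nat) (x : R) : 0 <= x ->
  (forall t, Q t -> (c <= t < c + tau)%N) ->
  \sum_(a <= t < b | Q t) x <= tau%:R * x.
Proof.
move=> x0 Qc; rewrite big_const_seq iter_addr_0 mulr_natl ler_wpMn2l//.
rewrite -size_filter -(size_iota c tau).
apply: uniq_leq_size; first by rewrite filter_uniq ?iota_uniq.
by move=> t; rewrite mem_filter mem_iota => /andP[/Qc].
Qed.

(** Each [t] has at most [tau] indices [u] in its window, and each [u] lies in the windows of at
    most [tau] indices [t]; each count contributes [tau%:R] times the sum of [N]. *)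
Lemma sum_window_le (a b tau : nat) (N : nat -> R) : (forall t, 0 <= N t) ->
  \sum_(a <= t < b) \sum_(maxn a (t - tau) <= u < t) (N u + N t) <=
  2 * tau%:R * \sum_(a <= t < b) N t.
Proof.
move=> N0; have widen t : (a <= t < b)%N ->
    \sum_(maxn a (t - tau) <= u < t) (N u + N t) =
    \sum_(a <= u < b | (t - tau <= u < t)%N) (N u + N t).
  move=> /andP[at_ tb].
  rewrite (big_nat_widenl _ a) ?leq_maxl// (big_nat_widen _ _ b) ?(ltnW tb)//.
  rewrite big_nat_cond [RHS]big_nat_cond; apply: eq_bigl => u.
  by case: (boolP (a <= u)%N) => au; rewrite ?andbF ?andFb// geq_max au !andTb; case: (u < b)%N.
(* The window is now a filter over a range that does not depend on [t], so the two sums can be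
   exchanged. *)
rewrite (eq_big_nat _ _ widen).
under eq_bigr do rewrite big_split/=.
rewrite big_split/= -mulrA mulr2n mulrDl mul1r; apply: lerD.
  rewrite (exchange_big_dep predT)//= mulr_sumr; apply: ler_sum => u _.
  apply: (@sum_window_const _ _ u.+1) => // t; lia.
rewrite mulr_sumr; apply: ler_sum => t _.
by apply: (@sum_window_const _ _ (t - tau)) => // u; lia.
Qed.

End Windows.

(** * Perturbed descent of the virtual iterates, for abstract directions *)

Section Epoch.
Context {disp : measure_display} {Omega : measurableType disp} {R : realType}.
Variable P : probability Omega R.
Context {d : nat}.
Local Notation simple := (simple_rv (@measurable disp Omega)).
Local Notation EX X := (Rintegral P setT X).

Let sM := sigma_algebra_measurable Omega.

Lemma simple_dot (X Y : Omega -> 'rV[R]_d) : simple X -> simple Y ->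
  simple (fun w => dot (X w) (Y w)).
Proof. exact: simple_comp2. Qed.

Variables (a m tau : nat) (gamma s : R) (xs : 'rV[R]_d).
Variables (x0 : Omega -> 'rV[R]_d) (g xh : nat -> Omega -> 'rV[R]_d).
Variables (e : nat -> R) (G : nat -> nat -> Omega -> 'I_d -> bool).
Local Notation inner t := (a <= t < a + m)%N.
Local Notation N t := (EX (fun w => dot (g t w) (g t w))).
Local Notation virtual t w := (x0 w - gamma *: \sum_(a <= u < t) g u w).

Hypothesis gamma_gt0 : 0 < gamma.
Hypothesis s_ge0 : 0 <= s.
Hypothesis simple_x0 : simple x0.
Hypothesis simple_g : forall t, inner t -> simple (g t).
Hypothesis simple_xh : forall t, inner t -> simple (xh t).
Hypothesis drift : forall t, inner t -> e t <= EX (fun w => dot (g t w) (xh t w - xs)).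
Hypothesis overlap : forall t u, inner t -> (a <= u < t)%N ->
  EX (fun w => \sum_v `|g u w 0 v| * `|g t w 0 v|) <= s / 2 * (N u + N t).
Hypothesis inconsistency : forall t w, inner t -> xh t w - virtual t w =
  gamma *: \sum_(maxn a (t - tau) <= u < t) g u w *m diag_mx (\row_v (G u t w v)%:R).

Lemma simple_virtual t : (a <= t <= a + m)%N -> simple (fun w => virtual t w).
Proof.
move=> /andP[at_ tb].
apply: (simple_comp2 sM (fun x y => x - gamma *: y)) => //.
under eq_fun do rewrite big_nat_cond.
apply: simple_sum => // u /andP[/andP[au ut] _]; apply: simple_g.
by rewrite au (leq_trans ut).
Qed.

Lemma dot_mask_le (x y : 'rV[R]_d) (b : 'I_d -> bool) :
  dot y (x *m diag_mx (\row_v (b v)%:R)) <= \sum_v `|x 0 v| * `|y 0 v|.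
Proof.
apply: ler_sum => v _; rewrite mul_mx_diag !mxE.
apply: le_trans (ler_norm _) _; rewrite !normrM mulrC.
by case: (b v); rewrite ?normr1 ?normr0 ?mulr1// mulr0 mul0r mulr_ge0.
Qed.

(** The masks [G] have no assumed measurability, so they are removed pointwise by [dot_mask_le]
    before the overlap terms are integrated one by one. *)
Lemma inconsistency_le t : inner t ->
  EX (fun w => dot (g t w) (xh t w - virtual t w)) <=
  gamma * (s / 2 * \sum_(maxn a (t - tau) <= u < t) (N u + N t)).
Proof.
move=> it; case/andP: (it) => at_ tm.
have early u : (maxn a (t - tau) <= u < t)%N -> (a <= u < t)%N.
  by rewrite geq_max -andbA => /and3P[-> _ ->].
have sg u : (maxn a (t - tau) <= u < t)%N -> simple (g u).
  by move=> /early /andP[au ut]; apply: simple_g; rewrite au (ltn_trans ut).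
have sabs u : (maxn a (t - tau) <= u < t)%N ->
    simple (fun w => \sum_v `|g u w 0 v| * `|g t w 0 v|).
  move=> iu; apply: (simple_comp2 sM (fun x y : 'rV[R]_d => \sum_v `|x 0 v| * `|y 0 v|)).
    exact: sg.
  exact: simple_g.
apply: (@le_trans _ _ (EX (fun w => gamma *
    \sum_(maxn a (t - tau) <= u < t) \sum_v `|g u w 0 v| * `|g t w 0 v|))).
  apply: le_Ex.
  - apply: simple_dot; first exact: simple_g.
    apply: (simple_comp2 sM (fun x y => x - y)); first exact: simple_xh.
    by apply: simple_virtual; rewrite at_ ltnW.
  - apply: (simple_comp sM (fun x => gamma * x)).
    under eq_fun do rewrite big_nat_cond.
    by apply: simple_sum => // u; rewrite andbT => /sabs.
  - move=> w; rewrite inconsistency// dotZr ler_pM2l// dot_sumr.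
    by apply: ler_sum => u _; exact: dot_mask_le.
rewrite Ex_Z; last first.
  under eq_fun do rewrite big_nat_cond.
  by apply: simple_sum => // u; rewrite andbT => /sabs.
rewrite ler_pM2l// mulr_sumr.
under eq_Rintegral do rewrite big_nat_cond.
rewrite Ex_sum; last by move=> u; rewrite andbT => /sabs.
rewrite [leRHS]big_nat_cond; apply: ler_sum => u; rewrite andbT => /early iu.
exact: overlap.
Qed.

Lemma virtual_step t : inner t ->
  EX (fun w => dot (virtual t.+1 w - xs) (virtual t.+1 w - xs)) <=
  EX (fun w => dot (virtual t w - xs) (virtual t w - xs)) - 2 * gamma * e t +
  gamma ^+ 2 * (N t + s * \sum_(maxn a (t - tau) <= u < t) (N u + N t)).
Proof.
move=> it; case/andP: (it) => at_ tm.
have sg := simple_g it; have sxh := simple_xh it.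
have sv : simple (fun w => virtual t w) by apply: simple_virtual; rewrite at_ ltnW.
(* The square is expanded with the read vector inserted into the cross term: its pairing with
   [xh t w - xs] is the drift, the rest is the inconsistency. *)
have expand w : dot (virtual t.+1 w - xs) (virtual t.+1 w - xs) =
    (dot (virtual t w - xs) (virtual t w - xs)
     + (- (2 * gamma)) * dot (g t w) (xh t w - xs))
    + ((2 * gamma) * dot (g t w) (xh t w - virtual t w)
       + gamma ^+ 2 * dot (g t w) (g t w)).
  rewrite big_nat_recr//= scalerDr opprD addrA.
  move: (x0 w - _) => y; move: (xh t w) (g t w) => z h.
  rewrite !dotE (dotC y h) (dotC xs h) (dotC xs y); ring.
under eq_Rintegral do rewrite expand.
have s1 : simple (fun w => dot (virtual t w - xs) (virtual t w - xs)).
  exact: (simple_comp sM (fun x => dot (x - xs) (x - xs))).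
have s2 : simple (fun w => dot (g t w) (xh t w - xs)).
  exact: (simple_comp2 sM (fun x y => dot x (y - xs))).
have s3 : simple (fun w => dot (g t w) (xh t w - virtual t w)).
  by apply: simple_dot => //; apply: (simple_comp2 sM (fun x y => x - y)).
have s4 : simple (fun w => dot (g t w) (g t w)) by exact: simple_dot.
have sZ (c : R) (X : Omega -> R) : simple X -> simple (fun w => c * X w).
  exact: simple_comp.
have sD (X Y : Omega -> R) : simple X -> simple Y -> simple (fun w => X w + Y w).
  exact: simple_comp2.
rewrite Ex_D; [|by apply: sD => //; exact: sZ|by apply: sD; exact: sZ].
rewrite Ex_D//; last exact: sZ.
rewrite Ex_D//; [|exact: sZ..].
rewrite !Ex_Z//.
have := inconsistency_le it; have := drift it; move: gamma_gt0.
set S := \sum_(_ <= u < t) (_ + _); set Nt := N t.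
set X1 := EX (fun w => dot (virtual t w - xs) _); set X2 := EX (fun w => dot _ (_ - xs)).
set X3 := EX (fun w => dot _ (xh t w - virtual t w)) => g0 h1 h2.
(* The right side minus the left side of the goal is exactly the sum of the quantities in [k1] and
   [k2]. *)
have k1 : 0 <= 2 * gamma * (X2 - e t) by rewrite mulr_ge0 ?mulr_ge0 ?subr_ge0// ltW.
have k2 : 0 <= 2 * gamma * (gamma * (s / 2 * S) - X3).
  by rewrite mulr_ge0 ?mulr_ge0 ?subr_ge0// ltW.
rewrite -subr_ge0; apply: le_trans (addr_ge0 k1 k2) _.
by apply: eq_ler; field.
Qed.

(** Telescope [virtual_step] over the epoch, drop the final squared distance, and let
    [sum_window_le] absorb the overlap terms into the constant. *)
Lemma epoch_descent :
  2 * gamma * \sum_(a <= t < a + m) e t <=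
  EX (fun w => dot (x0 w - xs) (x0 w - xs)) +
  gamma ^+ 2 * (1 + 2 * s * tau%:R) * \sum_(a <= t < a + m) N t.
Proof.
have N0 t : 0 <= N t by apply: Rintegral_ge0 => w _; exact: dot_ge0.
pose D t := N t + s * \sum_(maxn a (t - tau) <= u < t) (N u + N t).
have tel j : (j <= m)%N ->
    EX (fun w => dot (virtual (a + j) w - xs) (virtual (a + j) w - xs)) <=
    EX (fun w => dot (x0 w - xs) (x0 w - xs))
    - 2 * gamma * \sum_(a <= t < a + j) e t + gamma ^+ 2 * \sum_(a <= t < a + j) D t.
  elim: j => [|j IHj] jm.
    rewrite addn0 [\sum_(a <= t < a) e t]big_geq// [\sum_(a <= t < a) D t]big_geq//.
    rewrite !mulr0 subr0 addr0.
    under eq_Rintegral do rewrite big_geq// scaler0 subr0.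
    exact: lexx.
  have it : inner (a + j) by rewrite leq_addr ltn_add2l.
  rewrite addnS; apply: le_trans (virtual_step it) _.
  have := IHj (ltnW jm); rewrite ![\sum_(a <= t < (a + j).+1) _]big_nat_recr ?leq_addr//=.
  rewrite -/(D (a + j)); move: (\sum_(a <= t < _) D _) (\sum_(a <= t < _) e _) => SD Se.
  by rewrite !mulrDr; lra.
have am0 : 0 <= EX (fun w => dot (virtual (a + m) w - xs) (virtual (a + m) w - xs)).
  by apply: Rintegral_ge0 => w _; exact: dot_ge0.
have := le_trans am0 (tel m (leqnn m)).
have SD : \sum_(a <= t < a + m) D t <= (1 + 2 * s * tau%:R) * \sum_(a <= t < a + m) N t.
  rewrite big_split/= -mulr_sumr mulrDl mul1r lerD2l.
  apply: le_trans (ler_wpM2l s_ge0 (sum_window_le a (a + m) tau N0)) _.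
  by apply: eq_ler; ring.
have := ler_wpM2l (sqr_ge0 gamma) SD; rewrite mulrA; lra.
Qed.

End Epoch.

(** * The asynchronous run *)

Lemma divn_epoch (k m t : nat) : (k * m <= t < k * m + m)%N -> (t %/ m)%N = k.
Proof.
move=> /andP[kt tk]; have m0 : (0 < m)%N.
  by rewrite -(ltn_add2l (k * m)) addn0; exact: leq_ltn_trans tk.
apply/eqP; rewrite eqn_leq leq_divRL// kt andbT -ltnS ltn_divLR//.
by rewrite mulSn addnC.
Qed.

Section Run.
Context {disp : measure_display} {Omega : measurableType disp} {R : realType}.
Context {d n m : nat}.
Variables (P : probability Omega R) (fs : 'I_n -> 'rV[R]_d -> R).
Variables (gamma : R) (x0 : 'rV[R]_d) (E : execution Omega R d n m) (tau : nat).
Hypothesis run : kromagnon P fs gamma x0 E tau.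
Hypothesis m_gt0 : (0 < m)%N.
Local Notation simple := (simple_rv (@measurable disp Omega)).
Local Notation finitely_valued := (simple_rv [set: set Omega]).
Local Notation EX X := (Rintegral P setT X).

Let sM := sigma_algebra_measurable Omega.
Let sT : sigma_algebra setT [set: set Omega]. Proof. by split. Qed.

Lemma simple_direction F t : sigma_algebra setT F -> simple_rv F (xhat E t) ->
  simple_rv F (idx E t) -> simple_rv F (xtilde E (t %/ m)) ->
  simple_rv F (direction fs E t).
Proof.
move=> sF sx si sy.
exact: (simple_comp2 sF (fun i p => svrg_direction fs i p.1 p.2) si (simple_pair sF sx sy)).
Qed.

(* The masks G carry no measurability, so finiteness of the ranges is tracked
   first, as simplicity for the power-set sigma-algebra. *)
Lemma finitely_valued_xhat k : finitely_valued (xtilde E k) ->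
  forall t, (t %/ m)%N = k -> finitely_valued (xhat E t).
Proof.
have [G GE] := xhat_sub_virtual_iterate run.
move=> fk t; have [b] := ubnP t; elim: b t => // b IHb t tb tk.
have fdir u : (t %/ m * m <= u < t)%N -> finitely_valued (direction fs E u).
  move=> /andP[u1 u2]; have uk : (u %/ m)%N = k.
    apply/eqP; rewrite eqn_leq -{1}tk leq_div2r ?(ltnW u2)//.
    by rewrite leq_divRL// -tk.
  apply: (simple_direction sT); last by rewrite uk.
    by apply: IHb => //; apply: leq_trans u2 _.
  by apply: simple_finType => i; exact: I.
(* The mask is recoded as a finite function, an element of a finite type, so that it counts as
   finitely valued. *)
have -> : xhat E t = fun w => virtual_iterate fs gamma E t w + gamma *:
    \sum_(maxn (t %/ m * m) (t - tau) <= u < t)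
      direction fs E u w *m diag_mx (\row_v ([ffun v => G u t w v] v)%:R).
  apply/funext => w; rewrite -[LHS](subrK (virtual_iterate fs gamma E t w)) GE addrC.
  congr (_ + _ *: _); apply: eq_bigr => u _; congr (_ *m diag_mx _).
  by apply/rowP => v; rewrite !mxE ffunE.
apply: (simple_comp2 sT (fun x y => x + gamma *: y)).
  apply: (simple_comp2 sT (fun x y => x - gamma *: y)); first by rewrite tk.
  under eq_fun do rewrite big_nat_cond.
  by apply: simple_sum => // u; rewrite andbT => /fdir.
under eq_fun do rewrite big_nat_cond.
apply: simple_sum => // u; rewrite andbT geq_max -andbA => /and3P[u1 _ u2].
apply: (simple_comp2 sT (fun (x : 'rV[R]_d) (c : {ffun 'I_d -> bool}) =>
  x *m diag_mx (\row_v (c v)%:R)) (Y := fun w => [ffun v => G u t w v])).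
  by apply: fdir; rewrite u1.
by apply: simple_finType => c; exact: I.
Qed.

(** Finiteness passes from a snapshot to the reads of its epoch, and from these to the next
    snapshot, which is selected among them. *)
Lemma finitely_valued_xtilde k : finitely_valued (xtilde E k).
Proof.
elim: k => [|k IHk].
  rewrite (_ : xtilde E 0 = fun=> x0); first exact: simple_cst.
  by apply/funext => w; exact: start_at run w.
rewrite (_ : xtilde E k.+1 = fun w => xhat E (k * m + pick_idx E k w) w); last first.
  by apply/funext => w; exact: next_snapshot run k w.
apply: (simple_select sT (X := pick_idx E k)
  (Y := fun (j : 'I_m) => xhat E (k * m + j))) => [|j].
  by apply: simple_finType => j; exact: I.
 apply: finitely_valued_xhat IHk _ _.
by rewrite divnMDl// divn_small ?addn0.
Qed.

Lemma finite_range_xhat t : finite_set (range (xhat E t)).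
Proof. by have [] := finitely_valued_xhat (finitely_valued_xtilde (t %/ m)) (erefl _). Qed.

Lemma simple_xhat t : simple (xhat E t).
Proof.
apply: simple_row => [||v r]; [exact: sM|exact: finite_range_xhat|].
by rewrite -[X in measurable X]setTI; apply: (xhat_measurable run) => //; exact: measurable_set1.
Qed.

Lemma simple_idx t : simple (idx E t).
Proof. by apply: simple_finType; exact: (idx_measurable run). Qed.

Lemma simple_xtilde k : simple (xtilde E k).
Proof.
case: k => [|k].
  rewrite (_ : xtilde E 0 = fun=> x0); first exact: simple_cst.
  by apply/funext => w; exact: start_at run w.
rewrite (_ : xtilde E k.+1 = fun w => xhat E (k * m + pick_idx E k w) w); last first.
  by apply/funext => w; exact: next_snapshot run k w.
apply: (simple_select sM (X := pick_idx E k)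
  (Y := fun (j : 'I_m) => xhat E (k * m + j))) => [|j].
  by apply: simple_finType; exact: (pick_measurable run).
exact: simple_xhat.
Qed.

Lemma sigma_algebra_history a b c : sigma_algebra setT (history E a b c).
Proof. exact: smallest_sigma_algebra. Qed.

Lemma history_measurable a b c : history E a b c `<=` @measurable disp Omega.
Proof.
apply: smallest_sub => // A [[|]|].
- move=> [u [v [B [_ mB ->]]]]; rewrite -[X in measurable X]setTI.
  exact: (xhat_measurable run).
- by move=> [u [i [_ ->]]]; exact: (idx_measurable run).
move=> [j [v [B [_ mB ->]]]]; rewrite -[X in measurable X]setTI.
by apply: simple_measurable_fun => //; apply: (simple_comp sM (fun x : 'rV[R]_d => x 0 v));
  exact: simple_xtilde.
Qed.

Lemma history_xhat a b c t : (t < a)%N -> simple_rv (history E a b c) (xhat E t).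
Proof.
move=> ta; apply: simple_row => [||v r]; [exact: sigma_algebra_history|exact: finite_range_xhat|].
by apply: sub_sigma_algebra; left; left; exists t, v, [set r]; split.
Qed.

Lemma history_idx a b c t : (t < b)%N -> simple_rv (history E a b c) (idx E t).
Proof.
move=> tb; apply: simple_finType => i.
by apply: sub_sigma_algebra; left; right; exists t, i.
Qed.

Lemma history_xtilde a b c k : (k < c)%N -> simple_rv (history E a b c) (xtilde E k).
Proof.
move=> kc; apply: simple_row => [||v r]; first exact: sigma_algebra_history.
  by have [] := finitely_valued_xtilde k.
by apply: sub_sigma_algebra; right; exists k, v, [set r]; split.
Qed.

(** Averages out the sampled index. The history used contains the read [xhat E t] itself, but only
    the indices sampled strictly before [t]. *)
Lemma Ex_idx t (Y : 'I_n -> Omega -> R) :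
  (forall i, simple_rv (history E t.+1 t (t %/ m).+1) (Y i)) ->
  EX (fun w => Y (idx E t w) w) = EX (fun w => n%:R^-1 * \sum_i Y i w).
Proof.
have mX : discrete_rv (idx E t) by exact: (idx_measurable run).
have uX : uniform_rv P (idx E t) by exact: (idx_uniform run).
move=> sY; rewrite (Ex_uniform_select (@history_measurable _ _ _) mX uX
  (idx_independent run (t:=t)) sY) card_ord.
have sY' i : simple (Y i) by have [fY FY] := sY i; split=> // a; exact: history_measurable.
rewrite Ex_Z; last exact: simple_sum.
by rewrite Ex_sum.
Qed.

Lemma Ex_pick k (Y : nat -> Omega -> R) :
  (forall j : 'I_m, simple_rv (history E (k.+1 * m) (k.+1 * m) k.+1) (Y (k * m + j)%N)) ->
  EX (fun w => Y (k * m + pick_idx E k w)%N w) =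
  m%:R^-1 * \sum_(k * m <= t < k * m + m) EX (Y t).
Proof.
have mX : discrete_rv (pick_idx E k) by exact: (pick_measurable run).
have uX : uniform_rv P (pick_idx E k) by exact: (pick_uniform run).
move=> sY; rewrite (@Ex_uniform_select _ _ _ _ _ _ _ (@history_measurable _ _ _)
  mX uX (pick_independent run (k:=k)) (fun j : 'I_m => Y (k * m + j)%N) sY) card_ord.
congr (_ * _); have -> : \sum_(k * m <= t < k * m + m) EX (Y t) =
    \sum_(0 + k * m <= t < k * m + m) EX (Y t) by rewrite add0n.
by rewrite big_addn addKn big_mkord; apply: eq_bigr => j _; rewrite addnC.
Qed.

Lemma simple_dir t : simple (direction fs E t).
Proof.
apply: simple_direction sM _ _ _; [exact: simple_xhat|exact: simple_idx|].
exact: simple_xtilde.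
Qed.

(** * Contraction of the expected gap over one epoch of the run *)

Section SVRGRun.
Hypothesis n_gt0 : (0 < n)%N.
Hypothesis fs_diff : forall i x, differentiable (fs i) x.
Variables (L mu : R) (xstar : 'rV[R]_d).
Hypothesis L_ge0 : 0 <= L.
Hypothesis mu_gt0 : 0 < mu.
Hypothesis fs_convex : forall i, convex_function setT (fs i).
Hypothesis fs_lip : forall i, lipschitz_grad L (fs i).
Hypothesis f_strong : strongly_convex mu (avg fs).
Hypothesis xstar_min : forall x, avg fs xstar <= avg fs x.
Local Notation gap X := (EX (fun w => avg fs (X w) - avg fs xstar)).
Local Notation N t := (EX (fun w => dot (direction fs E t w) (direction fs E t w))).

Lemma simple_gap (X : Omega -> 'rV[R]_d) : simple X ->
  simple (fun w => avg fs (X w) - avg fs xstar).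
Proof. exact: (simple_comp sM (fun x => avg fs x - avg fs xstar)). Qed.

Lemma second_moment_le t :
  N t <= 4 * L * (gap (xhat E t) + gap (xtilde E (t %/ m))).
Proof.
have sF := sigma_algebra_history t.+1 t (t %/ m).+1.
have sH i := simple_comp2 sF
  (fun x y => dot (svrg_direction fs i x y) (svrg_direction fs i x y))
  (history_xhat t (t %/ m).+1 (ltnSn t)) (history_xtilde t.+1 t (ltnSn (t %/ m))).
rewrite (Ex_idx sH) -Ex_D; [|by apply: simple_gap; exact: simple_xhat|
  by apply: simple_gap; exact: simple_xtilde].
rewrite -Ex_Z; last first.
  exact: (simple_comp2 sM (fun x y => avg fs x - avg fs xstar + (avg fs y - avg fs xstar))
    (simple_xhat t) (simple_xtilde (t %/ m))).
apply: le_Ex => [||w].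
- exact: (simple_comp2 sM (fun x y => n%:R^-1 * \sum_i
    dot (svrg_direction fs i x y) (svrg_direction fs i x y))
    (simple_xhat t) (simple_xtilde (t %/ m))).
- exact: (simple_comp2 sM (fun x y =>
    4 * L * (avg fs x - avg fs xstar + (avg fs y - avg fs xstar)))
    (simple_xhat t) (simple_xtilde (t %/ m))).
exact: svrg_direction_second_moment.
Qed.

(** Averaging over the index replaces the direction by the full gradient at the read vector; the
    first-order bound follows once the nonnegative quadratic term is dropped. *)
Lemma gap_le_drift t :
  gap (xhat E t) <= EX (fun w => dot (direction fs E t w) (xhat E t w - xstar)).
Proof.
have sF := sigma_algebra_history t.+1 t (t %/ m).+1.
have sH i := simple_comp2 sF (fun x y => dot (svrg_direction fs i x y) (x - xstar))
  (history_xhat t (t %/ m).+1 (ltnSn t)) (history_xtilde t.+1 t (ltnSn (t %/ m))).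
rewrite (Ex_idx sH); apply: le_Ex => [||w].
- by apply: simple_gap; exact: simple_xhat.
- exact: (simple_comp2 sM (fun x y => n%:R^-1 * \sum_i
    dot (svrg_direction fs i x y) (x - xstar))
    (simple_xhat t) (simple_xtilde (t %/ m))).
rewrite -dot_suml -dotZl svrg_direction_unbiased//.
have := strongly_convex_grad_le xstar f_strong (differentiable_avg fs_diff (xhat E t w)).
rewrite -[xstar - _]opprB dotNr => h; rewrite lerBlDl -lerBlDr.
apply: le_trans h; rewrite lerDl mulr_ge0 ?dot_ge0//.
by rewrite divr_ge0// ltW.
Qed.

(** After exchanging the sums, coordinate [v] is weighted by its frequency p_v, which is at most
    Delta. *)
Lemma avg_supp_sqr_le (x : 'rV[R]_d) :
  n%:R^-1 * (\sum_i \sum_(v in supp fs i) x 0 v ^+ 2) <= sparsity fs * dot x x.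
Proof.
under eq_bigr do rewrite big_mkcond/=.
rewrite exchange_big/= /dot !mulr_sumr; apply: ler_sum => v _.
rewrite -expr2; apply: (@le_trans _ _ (coord_freq fs v * x 0 v ^+ 2)).
  rewrite coord_freqE// -mulrA mulr_suml ler_wpM2l ?invr_ge0//.
  by apply: ler_sum => i _; case: ifP; rewrite ?mul1r ?mul0r.
by rewrite ler_wpM2r ?sqr_ge0// coord_freq_le_sparsity.
Qed.

(** The earlier direction belongs to the history before [idx E t] is drawn, so restricting it to the
    sampled support costs a factor Delta = s^2. With weight [s] in Young's inequality, both terms
    get the coefficient s / 2. *)
Lemma overlap_le u t : (u < t)%N -> (u %/ m)%N = (t %/ m)%N ->
  EX (fun w => \sum_v `|direction fs E u w 0 v| * `|direction fs E t w 0 v|) <=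
  Num.sqrt (sparsity fs) / 2 * (N u + N t).
Proof.
move=> ut uk; have D0 := sparsity_ge0 fs; set s := Num.sqrt _.
(* Young's weight must be positive; if [s = 0], all supports are empty and every direction
   vanishes. *)
have [s0|s0] := eqVneq s 0.
  have dir0 w v : direction fs E t w 0 v = 0.
    apply: direction_supp; apply: (coord_freq_eq0 n_gt0).
    apply/eqP; rewrite eq_le; apply/andP; split; last by rewrite mulr_ge0 ?invr_ge0.
    apply: le_trans (coord_freq_le_sparsity fs v) _.
    by move/eqP: s0; rewrite sqrtr_eq0.
  have mul_norm0 (a b : R) : b = 0 -> `|a| * `|b| = 0.
    by move=> ->; rewrite normr0 mulr0.
  have -> : (fun w => \sum_v `|direction fs E u w 0 v| * `|direction fs E t w 0 v|) =
      fun=> 0.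
    apply/funext => w; apply: big1 => v _.
    exact: mul_norm0 (dir0 w v).
  by rewrite Ex_cst s0 mul0r mul0r.
have sp : 0 < s by rewrite lt_def s0 sqrtr_ge0.
have sF := sigma_algebra_history t.+1 t (t %/ m).+1.
pose Y i w := \sum_(v in supp fs i) direction fs E u w 0 v ^+ 2.
have sH i : simple_rv (history E t.+1 t (t %/ m).+1) (Y i).
  apply: (simple_comp sF (fun x : 'rV[R]_d => \sum_(v in supp fs i) x 0 v ^+ 2)).
  apply: (simple_direction sF).
  - by apply: history_xhat; rewrite ltnS ltnW.
  - exact: history_idx.
  - by apply: history_xtilde; rewrite uk.
have sYi : simple (fun w => Y (idx E t w) w).
  exact: (simple_comp2 sM (fun (x : 'rV[R]_d) i => \sum_(v in supp fs i) x 0 v ^+ 2)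
    (simple_dir u) (simple_idx t)).
have sN r : simple (fun w => dot (direction fs E r w) (direction fs E r w)).
  exact: (simple_comp sM (fun x => dot x x) (simple_dir r)).
have sZ (c : R) (X : Omega -> R) : simple X -> simple (fun w => c * X w).
  exact: simple_comp.
have youngE : EX (fun w => (2 * s)^-1 * Y (idx E t w) w +
      s / 2 * dot (direction fs E t w) (direction fs E t w)) =
    (2 * s)^-1 * EX (fun w => n%:R^-1 * \sum_i Y i w) + s / 2 * N t.
  apply: etrans (Ex_D P (sZ _ _ sYi) (sZ _ _ (sN t))) _.
  apply: congr2 (Ex_Z P _ (sN t)).
  exact: etrans (Ex_Z P _ sYi) (congr1 _ (Ex_idx sH)).
have YE : EX (fun w => n%:R^-1 * \sum_i Y i w) <= s ^+ 2 * N u.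
  apply: le_trans (_ : _ <= EX (fun w => s ^+ 2 *
    dot (direction fs E u w) (direction fs E u w))) _; last first.
    by apply: eq_ler; exact: (Ex_Z P _ (sN u)).
  apply: le_Ex => [||w].
  - exact: (simple_comp sM (fun x : 'rV[R]_d =>
      n%:R^-1 * \sum_i \sum_(v in supp fs i) x 0 v ^+ 2) (simple_dir u)).
  - exact: sZ _ _ (sN u).
  rewrite sqr_sqrtr// /Y; move: (direction fs E u w) => x.
  exact: avg_supp_sqr_le.
apply: le_trans (_ : _ <= (2 * s)^-1 * (s ^+ 2 * N u) + s / 2 * N t) _; last first.
  have young_const (a b : R) : s / 2 * (a + b) = (2 * s)^-1 * (s ^+ 2 * a) + s / 2 * b.
    by field.
  exact: eq_ler (esym (young_const (N u) (N t))).
apply: le_trans (_ : _ <= (2 * s)^-1 * EX (fun w => n%:R^-1 * \sum_i Y i w) +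
  s / 2 * N t) _; last by rewrite lerD2r ler_pM2l// invr_gt0 mulr_gt0.
apply: le_trans (_ : _ <= EX (fun w => (2 * s)^-1 * Y (idx E t w) w +
  s / 2 * dot (direction fs E t w) (direction fs E t w))) (eq_ler youngE).
apply: le_Ex => [||w].
- exact: (simple_comp2 sM (fun x y : 'rV[R]_d => \sum_v `|x 0 v| * `|y 0 v|)
    (simple_dir u) (simple_dir t)).
- exact: (simple_comp2 sM (fun x y : R => (2 * s)^-1 * x + s / 2 * y) sYi (sN t)).
by apply: sum_norm_mul_le => // v; exact: direction_supp.
Qed.

(** Strong convexity expanded at [xstar], where the gradient is zero. *)
Lemma dist_sqr_le k :
  EX (fun w => dot (xtilde E k w - xstar) (xtilde E k w - xstar)) <=
  2 / mu * gap (xtilde E k).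
Proof.
rewrite -(Ex_Z P _ (simple_gap (simple_xtilde k))); apply: le_Ex => [||w].
- exact: (simple_comp sM (fun x => dot (x - xstar) (x - xstar)) (simple_xtilde k)).
- exact: (simple_comp sM (fun x => 2 / mu * (avg fs x - avg fs xstar)) (simple_xtilde k)).
move: (xtilde E k w) => x.
have := strongly_convex_grad_le x f_strong (differentiable_avg fs_diff xstar).
rewrite (grad_avg_min fs_diff xstar_min) dot0l addr0 -lerBrDl => h.
have -> : dot (x - xstar) (x - xstar) = 2 / mu * (mu / 2 * dot (x - xstar) (x - xstar)).
  by field; rewrite gt_eqF.
by rewrite ler_wpM2l// divr_ge0// ltW.
Qed.

Lemma gap_ge0 (X : Omega -> 'rV[R]_d) : 0 <= gap X.
Proof. by apply: Rintegral_ge0 => w _; rewrite subr_ge0. Qed.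

Hypothesis gamma_gt0 : 0 < gamma.

Lemma sum_gap_epoch k :
  2 * gamma * \sum_(k * m <= t < k * m + m) gap (xhat E t) <=
  2 / mu * gap (xtilde E k) +
  gamma ^+ 2 * (1 + 2 * Num.sqrt (sparsity fs) * tau%:R) * (4 * L *
    (\sum_(k * m <= t < k * m + m) gap (xhat E t) + m%:R * gap (xtilde E k))).
Proof.
have [G GE] := xhat_sub_virtual_iterate run.
have inconsistency t w : (k * m <= t < k * m + m)%N ->
    xhat E t w - (xtilde E k w - gamma *: \sum_(k * m <= u < t) direction fs E u w) =
    gamma *: \sum_(maxn (k * m) (t - tau) <= u < t)
      direction fs E u w *m diag_mx (\row_v (G u t w v)%:R).
  by move=> it; have := GE t w; rewrite /virtual_iterate (divn_epoch it).
have overlap t u : (k * m <= t < k * m + m)%N -> (k * m <= u < t)%N ->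
    EX (fun w => \sum_v `|direction fs E u w 0 v| * `|direction fs E t w 0 v|) <=
    Num.sqrt (sparsity fs) / 2 * (N u + N t).
  move=> it /andP[ku ut]; apply: overlap_le => //.
  have /andP[_ tm] := it.
  by rewrite (divn_epoch it) (@divn_epoch k)// ku (ltn_trans ut).
have descent := epoch_descent gamma_gt0 (sqrtr_ge0 (sparsity fs)) (simple_xtilde k)
  (fun t _ => simple_dir t) (fun t _ => simple_xhat t)
  (fun t _ => gap_le_drift t) overlap inconsistency.
apply: le_trans descent (lerD (dist_sqr_le k) _).
have kappa_ge0 : 0 <= gamma ^+ 2 * (1 + 2 * Num.sqrt (sparsity fs) * tau%:R).
  by rewrite mulr_ge0 ?sqr_ge0// addr_ge0// !mulr_ge0// sqrtr_ge0.
apply: (ler_wpM2l kappa_ge0).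
have -> : m%:R * gap (xtilde E k) = \sum_(k * m <= t < k * m + m) gap (xtilde E k).
  by rewrite sumr_const_nat addKn mulr_natl.
rewrite -big_split mulr_sumr [leLHS]big_nat [leRHS]big_nat; apply: ler_sum => t it.
by have := second_moment_le t; rewrite (divn_epoch it).
Qed.

(** Turns the bound on the sum over an epoch into a bound at the next snapshot, drawn uniformly
    among the reads. *)
Lemma gap_next k :
  gap (xtilde E k.+1) = m%:R^-1 * \sum_(k * m <= t < k * m + m) gap (xhat E t).
Proof.
rewrite -(@Ex_pick k (fun t w => avg fs (xhat E t w) - avg fs xstar)).
  by apply: eq_Rintegral => w _; rewrite (next_snapshot run).
move=> j; apply: (simple_comp (sigma_algebra_history _ _ _)
  (fun x => avg fs x - avg fs xstar)).
by apply: history_xhat; rewrite mulSn addnC ltn_add2r.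
Qed.

Lemma gap_contraction (theta : R) k :
  theta = ((mu * gamma * m%:R)^-1
         + 2 * L * (1 + 2 * Num.sqrt (sparsity fs) * tau%:R)
             * (gamma + tau%:R * mu * gamma ^+ 2))
       / (1 - 2 * L * (1 + 2 * Num.sqrt (sparsity fs) * tau%:R)
             * (gamma + tau%:R * mu * gamma ^+ 2)) ->
  0 < theta -> gap (xtilde E k.+1) <= theta * gap (xtilde E k).
Proof.
move=> thetaE theta_gt0; rewrite gap_next.
have := sum_gap_epoch k; have := gap_ge0 (xtilde E k).
have : 0 <= \sum_(k * m <= t < k * m + m) gap (xhat E t).
  by apply: sumr_ge0 => t _; exact: gap_ge0.
have : 0 <= 2 * Num.sqrt (sparsity fs) * tau%:R by rewrite !mulr_ge0// sqrtr_ge0.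
have M0 : 0 < m%:R :> R by rewrite ltr0n.
move: thetaE theta_gt0.
move: (\sum_(_ <= t < _) _) (gap _) (2 * Num.sqrt (sparsity fs) * tau%:R) (m%:R) M0.
move=> S g kappa M M0 -> theta_gt0 kappa0 S0 g0 epoch_le.
have taumu0 : 0 <= tau%:R * mu * gamma by rewrite !mulr_ge0// ltW.
set q := 2 * L * (1 + kappa) * (gamma + tau%:R * mu * gamma ^+ 2) in theta_gt0 *.
have qE : q = 2 * L * (1 + kappa) * gamma * (1 + tau%:R * mu * gamma) by rewrite /q; ring.
have k1_ge0 : 0 <= 1 + kappa by rewrite addr_ge0.
have t1_ge0 : 0 <= 1 + tau%:R * mu * gamma by rewrite addr_ge0.
have gamma_ge0 := ltW gamma_gt0.
have q0 : 0 <= q by rewrite qE !mulr_ge0.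
have num_gt0 : 0 < (mu * gamma * M)^-1 + q.
  by rewrite ltr_wpDr// invr_gt0 !mulr_gt0.
(* The numerator of theta is positive, so [0 < theta] forces a positive denominator. *)
have q1 : 0 < 1 - q by move: theta_gt0; rewrite pmulr_rgt0// invr_gt0.
rewrite mulrAC ler_pdivlMr// mulrC -(ler_pM2l M0) mulrA.
(* The two sides differ by the factor [1 + tau%:R * mu * gamma], which is at least 1. *)
have base : 2 * L * (1 + kappa) * gamma <= q.
  by rewrite qE ler_peMr ?lerDl// !mulr_ge0.
have le1 : 2 * gamma * S <= 2 * gamma * (g / (mu * gamma) + q * (S + M * g)).
  apply: le_trans epoch_le _.
  have -> : 2 / mu * g + gamma ^+ 2 * (1 + kappa) * (4 * L * (S + M * g)) =
    2 * gamma * (g / (mu * gamma) + 2 * L * (1 + kappa) * gamma * (S + M * g)).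
    by field; rewrite !gt_eqF.
  rewrite ler_pM2l ?mulr_gt0// lerD2l ler_wpM2r// addr_ge0// mulr_ge0// ltW//.
(* With [2 * gamma] cancelled, moving [q * S] to the left and dividing by [M * (1 - q)] yields the
   factor theta. *)
rewrite ler_pM2l ?mulr_gt0// in le1.
have -> : M * (1 - q) * (M^-1 * S) = S - q * S by field; rewrite gt_eqF.
have -> : M * (((mu * gamma * M)^-1 + q) * g) = g / (mu * gamma) + q * (M * g).
  by field; rewrite !gt_eqF.
by rewrite mulrDr in le1; rewrite lerBlDr -addrA [q * _ + q * S]addrC.
Qed.

End SVRGRun.
End Run.

(** A nonnegative norm is bounded by [L] times the distance, so a negative [L] forces the distance
    to be zero. *)
Lemma lipschitz_neg_trivial (R : realType) (d : nat) (L : R) (g : 'rV[R]_d -> R)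
    (x y : 'rV[R]_d) :
  L < 0 -> lipschitz_grad L g -> x = y.
Proof.
move=> L0 gL; have := gL x y => h.
have e0 : enorm (x - y) = 0.
  apply/eqP; rewrite eq_le enorm_ge0 andbT -(nmulr_rge0 _ L0).
  exact: le_trans (enorm_ge0 _) h.
by apply/subr0_eq/dot_eq0; rewrite -enorm_sqr e0 expr0n.
Qed.

Theorem theorem15 (R : realType) (d n m tau : nat)
    (fs : 'I_n -> 'rV[R]_d -> R) (L mu gamma theta : R) (x0 xstar : 'rV[R]_d)
    (disp : measure_display) (Omega : measurableType disp)
    (P : probability Omega R) (E : execution Omega R d n m)
    (n_gt0 : (0 < n)%N) (m_gt0 : (0 < m)%N)
    (fs_convex : forall i, convex_function setT (fs i))
    (fs_diff : forall i x, differentiable (fs i) x)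
    (fs_lip : forall i, lipschitz_grad L (fs i))
    (mu_gt0 : 0 < mu)
    (f_strong : strongly_convex mu (avg fs))
    (xstar_min : forall x, avg fs xstar <= avg fs x)
    (gamma_gt0 : 0 < gamma)
    (run : kromagnon P fs gamma x0 E tau)
    (thetaE : theta =
       ((mu * gamma * m%:R)^-1
         + 2 * L * (1 + 2 * Num.sqrt (sparsity fs) * tau%:R)
             * (gamma + tau%:R * mu * gamma ^+ 2))
       / (1 - 2 * L * (1 + 2 * Num.sqrt (sparsity fs) * tau%:R)
             * (gamma + tau%:R * mu * gamma ^+ 2)))
    (theta_bounds : 0 < theta < 1) :
  forall k : nat,
    ('E_P[fun w => avg fs (xtilde E k w)] - (avg fs xstar)%:E
      <= (theta ^+ k * (avg fs x0 - avg fs xstar))%:E)%E.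
Proof.
move=> k; have /andP[theta_gt0 _] := theta_bounds.
have sM := sigma_algebra_measurable Omega.
have sf j : simple_rv (@measurable disp Omega) (fun w => avg fs (xtilde E j w)).
  exact: (simple_comp sM (avg fs) (simple_xtilde run m_gt0 j)).
rewrite (expectation_Rintegral P (sf k)) -EFinB lee_fin.
(* Writes the left side as the expected gap, the quantity that [gap_contraction] controls. *)
rewrite -[X in _ - X](Ex_cst P) -(Ex_B P (sf k) (simple_cst sM _)).
(* A negative Lipschitz constant is only possible when d = 0. *)
have [L_ge0|L_lt0] := leP 0 L; last first.
  have -> : (fun w => avg fs (xtilde E k w) - avg fs xstar) = fun=> 0.
    apply/funext => w.
    by rewrite (lipschitz_neg_trivial (xtilde E k w) xstar L_lt0 (fs_lip (Ordinal n_gt0))) subrr.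
  by rewrite Ex_cst mulr_ge0 ?subr_ge0// exprn_ge0// ltW.
elim: k => [|k IHk].
  rewrite expr0 mul1r.
  have -> : (fun w => avg fs (xtilde E 0 w) - avg fs xstar) = fun=> avg fs x0 - avg fs xstar.
    by apply/funext => w; rewrite (start_at run).
  by rewrite Ex_cst.
rewrite exprS -mulrA.
apply: le_trans (_ : _ <= theta * _) (ler_wpM2l (ltW theta_gt0) IHk).
exact: (gap_contraction run m_gt0 n_gt0 fs_diff L_ge0 mu_gt0 fs_convex fs_lip f_strong
  xstar_min gamma_gt0 k thetaE theta_gt0).
Qed.
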